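(* Fix an integer $n\ge1$ and an $n$-core $\delta$. Then $$\prod_{i,j}\prod_{k=0}^{n-1}\frac{1}{1-x_iy_jq^{2k}}=\sum_\lambda\mathcal{G}_\lambda(X;q)\,\mathcal{G}_\lambda(Y;q),$$ where the sum is over all partitions $\lambda$ with $n$-core $\tilde\lambda=\delta$.
   Context: $X=(x_1,x_2,\ldots)$ and $Y=(y_1,y_2,\ldots)$ are two sets of variables and the identity is one of formal power series. Ribbons and ribbon functions: fix $n\ge1$. Partitions are identified with their Young diagrams (first row on top); ''connected'' means connected through edges. A ribbon is a connected skew shape with exactly $n$ squares containing no $2\times 2$ square; its spin is its number of rows minus 1. The spin $s(T)$ of a shape tiled by ribbons is the sum of the spins of its ribbons. A horizontal ribbon strip is a skew shape tiled by ribbons such that the topright-most square of every ribbon touches the northern edge of the shape; such a tiling is unique if it exists. A semistandard ribbon tableau $T$ of shape $\lambda/\mu$ is a chain of partitions $\mu=\mu^0\subset\mu^1\subset\cdots\subset\mu^r=\lambda$ with each $\mu^{i}/\mu^{i-1}$ a (possibly empty) horizontal ribbon strip, whose ribbons are labelled $i$; its weight $w(T)$ is the composition whose $i$-th part is the number of ribbons labelled $i$. Put $\mathcal{G}_{\lambda/\mu}(X;q)=\sum_T q^{s(T)}\mathbf{x}^{w(T)}$, summed over semistandard ribbon tableaux of shape $\lambda/\mu$. The $n$-core $\tilde\lambda$ of $\lambda$ is the partition obtained by removing $n$-ribbons from $\lambda$ until no longer possible; an $n$-core is a partition equal to its own $n$-core. Put $\mathcal{G}_\lambda:=\mathcal{G}_{\lambda/\tilde\lambda}$.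 *)

(* Defs.v *)
From HB Require Import structures.
From Stdlib Require Export Relation_Operators.
From mathcomp Require Export all_boot all_order all_algebra finmap.
From mathcomp Require Export mathcomp_extra boolp classical_sets functions.
From mathcomp Require Export cardinality fsbigop.
From mathcomp.multinomials Require Export monalg.

Set Implicit Arguments.
Unset Strict Implicit.
Unset Printing Implicit Defensive.

Import GRing.Theory.

Local Open Scope classical_set_scope.
Local Open Scope ring_scope.

(** * Formal power series in an arbitrary set of variables

   A power series over [R] in the variables [V] is the family of its
   coefficients, indexed by the monomials [{cmonom V}], i.e., the finitely
   supported exponent functions [V -> nat]. *)

Record fps (R : Type) (V : choiceType) := FPS { coef : {cmonom V} -> R }.
Coercion coef : fps >-> Funclass.

HB.instance Definition _ (R : Type) (V : choiceType) :=
  [isNew for @coef R V].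
HB.instance Definition _ (R : choiceType) (V : choiceType) :=
  [Choice of fps R V by <:].

Definition factorizations {V : choiceType} (m : {cmonom V}) :
    set ({cmonom V} * {cmonom V}) :=
  [set p | mmul p.1 p.2 = m].

Section FpsRing.
Context {R : comNzRingType} {V : choiceType}.
Local Notation fpsRV := (fps R V).
Implicit Types (f g h : fpsRV) (m a b c : {cmonom V}).

Lemma fpsP f g : (forall m, f m = g m) <-> f = g.
Proof.
by split=> [e|->//]; case: f g e => [f] [g] /= e; congr FPS; apply/funext.
Qed.

Definition fps_add f g : fpsRV := FPS (fun m => f m + g m).
Definition fps_opp f : fpsRV := FPS (fun m => - f m).
Definition fps_const (x : R) : fpsRV := FPS (fun m => if m == mone then x else 0).
Definition fps_mul f g : fpsRV :=
  FPS (fun m => \sum_(p \in factorizations m) f p.1 * g p.2).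

Lemma fps_addA : associative fps_add.
Proof. by move=> f g h; apply/fpsP => m /=; rewrite addrA. Qed.
Lemma fps_addC : commutative fps_add.
Proof. by move=> f g; apply/fpsP => m /=; rewrite addrC. Qed.
Lemma fps_add0 : left_id (fps_const 0) fps_add.
Proof. by move=> f; apply/fpsP => m /=; rewrite if_same add0r. Qed.
Lemma fps_addN : left_inverse (fps_const 0) fps_opp fps_add.
Proof. by move=> f; apply/fpsP => m /=; rewrite if_same addNr. Qed.

HB.instance Definition _ :=
  GRing.isZmodule.Build fpsRV fps_addA fps_addC fps_add0 fps_addN.

Lemma finite_divisors m : finite_set [set a | exists b, mmul a b = m].
Proof.
pose W := {ffun finsupp m -> 'I_(mdeg m).+1}.
pose F (w : W) : {cmonom V} := [cmonom (w i : nat) | i : finsupp m]%M.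
apply: (@sub_finite_set _ _ (F @` [set: W])); last first.
  exact/finite_image/finite_finset.
move=> a [b abm]; exists [ffun i => inord (a (val i))] => //.
have lea i : (a i <= m i)%N by rewrite -abm cmM leq_addr.
apply/eqP/cmP => i; rewrite cmE.
have [im|im] := boolP (i \in finsupp m); last first.
  rewrite fsfun_ffun insubN//=; apply/esym/eqP.
  by rewrite -leqn0 (leq_trans (lea i))// leqn0 cmE_eq0.
rewrite fsfun_ffun insubT/= ffunE/= inordK// ltnS (leq_trans (lea i))//.
by rewrite mdegE (big_fsetD1 i)//= leq_addr.
Qed.

Definition divisors m : {fset {cmonom V}} :=
  fset_set [set a | exists b, mmul a b = m].

Lemma divisorsP m a : reflect (exists b, mmul a b = m) (a \in divisors m).
Proof.
rewrite in_fset_set; last exact: finite_divisors.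
by apply: (iffP idP) => [/set_mem//|?]; apply/mem_set.
Qed.

Lemma divisors_l a b m : mmul a b \in divisors m -> a \in divisors m.
Proof.
by case/divisorsP => c <-; apply/divisorsP; exists (mmul b c); rewrite mulmA.
Qed.

Lemma divisors_r a b m : mmul a b \in divisors m -> b \in divisors m.
Proof. by rewrite mulmC; apply: divisors_l. Qed.

Lemma divisors_id m : m \in divisors m.
Proof. by apply/divisorsP; exists mone; rewrite mulm1. Qed.

Lemma fps_mulE f g m a : a \in divisors m -> fps_mul f g a =
  \sum_(b <- divisors m) \sum_(c <- divisors m | mmul b c == a) f b * g c.
Proof.
move=> am.
under eq_bigr do rewrite big_mkcond.
rewrite /fps_mul/=.
pose D := divisors m.
pose r := [seq (b, c) | b <- D, c <- D].
transitivity (\sum_(p <- r) if mmul p.1 p.2 == a then f p.1 * g p.2 else 0).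
  rewrite -big_mkcond (@fsbigE _ _ _ _ _ [seq p <- r | mmul p.1 p.2 == a]).
  - rewrite big_filter_cond; apply: eq_bigl => p.
    by rewrite -[RHS]andbT; case: eqP => //= e; apply/mem_set.
  - by rewrite filter_uniq// allpairs_uniq ?fset_uniq// => -[? ?] [? ?].
  - by move=> p /=; rewrite mem_filter => /andP[/eqP].
  - move=> [b c] /= e; rewrite mem_filter/= e eqxx/= => /negP[].
    apply/allpairsP; exists (b, c) => /=; rewrite -e in am.
    by split=> //; [apply: divisors_l am|apply: divisors_r am].
by rewrite big_allpairs.
Qed.


Lemma fps_mulA : associative fps_mul.
Proof.
move=> f g h; apply/fpsP => m; pose D := divisors m.
rewrite !(fps_mulE _ _ (divisors_id m)).
transitivity (\sum_(a <- D) \sum_(b <- D) \sum_(c <- D)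
    if mmul a (mmul b c) == m then f a * (g b * h c) else 0).
  apply: eq_bigr => a _; rewrite big_mkcond/=.
  transitivity (\sum_(d <- D) \sum_(b <- D) \sum_(c <- D)
      if (mmul a d == m) && (mmul b c == d) then f a * (g b * h c) else 0).
    rewrite 2!big_seq; apply: eq_bigr => d dD; case: eqP => _ /=; last first.
      by rewrite big1// => b _; rewrite big1.
    rewrite -[X in _ * X]/(fps_mul g h d) (fps_mulE _ _ dD) mulr_sumr; apply: eq_bigr => b _.
    by rewrite mulr_sumr big_mkcond.
  rewrite exchange_big/=; apply: eq_bigr => b _.
  rewrite exchange_big/=; apply: eq_bigr => c _.
  case: eqP => [e|ne]; last first.
    by rewrite big1// => d _; case: andP => // -[/eqP + /eqP ed]; rewrite -ed.
  rewrite (big_fsetD1 (mmul b c))/=; last first.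
    by apply: (@divisors_r a); rewrite e divisors_id.
  rewrite e (eqxx m) (eqxx (mmul b c)) /=.
  rewrite big1_fset ?addr0// => d; rewrite in_fsetD1 => /andP[dn _] _.
  by rewrite [mmul b c == d]eq_sym (negPf dn) andbF.
transitivity (\sum_(d <- D) \sum_(c <- D) \sum_(a <- D) \sum_(b <- D)
    if (mmul d c == m) && (mmul a b == d) then f a * (g b * h c) else 0);
    last first.
  rewrite 2!big_seq; apply: eq_bigr => d dD; rewrite [RHS]big_mkcond/=.
  apply: eq_bigr => c _; case: eqP => _ /=; last first.
    by rewrite big1// => b _; rewrite big1.
  rewrite -[X in X * _]/(fps_mul f g d) (fps_mulE _ _ dD) mulr_suml; apply: eq_bigr => a _.
  rewrite mulr_suml [RHS]big_mkcond; apply: eq_bigr => b _.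
  by case: ifP; rewrite ?mulrA.
rewrite [RHS]exchange_big/=.
transitivity (\sum_(c <- D) \sum_(a <- D) \sum_(b <- D)
    if mmul a (mmul b c) == m then f a * (g b * h c) else 0).
  rewrite [RHS]exchange_big/=; apply: eq_bigr => a _.
  by rewrite exchange_big.
apply: eq_bigr => c _; rewrite [RHS]exchange_big/=; apply: eq_bigr => a _.
rewrite [RHS]exchange_big/=; apply: eq_bigr => b _; rewrite mulmA.
case: eqP => [e|ne]; last first.
  by rewrite big1// => d _; case: andP => // -[/eqP + /eqP ed]; rewrite -ed.
rewrite (big_fsetD1 (mmul a b))/=; last first.
  by apply: (@divisors_l _ c); rewrite e divisors_id.
rewrite e (eqxx m) (eqxx (mmul a b)) /=.
rewrite big1_fset ?addr0// => d; rewrite in_fsetD1 => /andP[dn _] _.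
by rewrite [mmul a b == d]eq_sym (negPf dn) andbF.
Qed.

Lemma fps_mulC : commutative fps_mul.
Proof.
move=> f g; apply/fpsP => m; rewrite !(fps_mulE _ _ (divisors_id m)).
under eq_bigr do rewrite big_mkcond.
rewrite exchange_big/=; apply: eq_bigr => a _; rewrite [RHS]big_mkcond.
by apply: eq_bigr => b _; rewrite mulmC mulrC.
Qed.

Lemma fps_mul1 : left_id (fps_const 1) fps_mul.
Proof.
move=> f; apply/fpsP => m; rewrite (fps_mulE _ _ (divisors_id m)).
rewrite (big_fsetD1 mone)/=; last by apply/divisorsP; exists m; rewrite mul1m.
rewrite [X in _ + X]big1_fset ?addr0 => [|a]; last first.
  rewrite in_fsetD1 => /andP[/negPf a1 _] _.
  by rewrite big1// => b _; rewrite a1 mul0r.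
rewrite eqxx big_mkcond (big_fsetD1 m) ?divisors_id//= mul1m eqxx mul1r.
rewrite big1_fset ?addr0// => b; rewrite in_fsetD1 mul1m.
by move=> /andP[/negPf->].
Qed.

Lemma fps_mulDl : left_distributive fps_mul fps_add.
Proof.
move=> f g h; apply/fpsP => m.
transitivity (fps_mul f h m + fps_mul g h m) => //.
rewrite !(fps_mulE _ _ (divisors_id m)) -big_split; apply: eq_bigr => a _ /=.
by rewrite -big_split; apply: eq_bigr => b _ /=; rewrite mulrDl.
Qed.

Lemma fps_1neq0 : fps_const 1 != 0 :> fpsRV.
Proof.
apply/eqP => /(congr1 (fun f : fpsRV => f mone))/=.
by rewrite eqxx => /eqP; rewrite oner_eq0.
Qed.

HB.instance Definition _ := GRing.Zmodule_isComNzRing.Build fpsRV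
  fps_mulA fps_mulC fps_mul1 fps_mulDl fps_1neq0.

Definition fps_unit : pred fpsRV := fun f => `[< exists g, g * f = 1 >].
Definition fps_inv f : fpsRV := xget f [set g | g * f = 1].

Lemma fps_mulVf : {in fps_unit, left_inverse 1 fps_inv *%R}.
Proof. by move=> f /asboolP uf; exact: (xgetPex f uf). Qed.

Lemma fps_unitP f g : g * f = 1 -> fps_unit f.
Proof. by move=> gf; apply/asboolP; exists g. Qed.

Lemma fps_inv_out : {in [predC fps_unit], fps_inv =1 id}.
Proof.
move=> f /negP nuf; rewrite /fps_inv; case: xgetP => // g _ gf.
by case: nuf; apply: fps_unitP gf.
Qed.

HB.instance Definition _ := GRing.ComNzRing_hasMulInverse.Build fpsRV
  fps_mulVf fps_unitP fps_inv_out.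

Definition fps_var (v : V) : fpsRV := FPS (fun m => if m == ucm v then 1 else 0).

(* Infinite sums and products are taken coefficientwise. *)

Definition fps_summable (J : choiceType) (A : set J) (F : J -> fpsRV) :=
  forall m, finite_set [set j | A j /\ F j m != 0].

(* Only meaningful for summable families: a coefficient in which infinitely many
   terms are nonzero is sent to 0. *)
Definition fps_sum (J : choiceType) (A : set J) (F : J -> fpsRV) : fpsRV :=
  FPS (fun m => \sum_(j \in A) F j m).

(* [P] is the limit of the finite partial products of [F]: each coefficient is
   eventually constant along the directed set of finite subsets of [J]. *)
Definition fps_has_prod (J : choiceType) (F : J -> fpsRV) (P : fpsRV) :=
  forall m, exists J0 : {fset J}, forall J1 : {fset J},
    (J0 `<=` J1)%fset -> (\prod_(j <- J1) F j) m = P m.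

End FpsRing.

(** * Partitions, ribbons and ribbon tableaux *)

Record partition := Partition {
  parts :> seq nat;
  _ : sorted geq parts && (0%N \notin parts)
}.

HB.instance Definition _ := [isSub for parts].
HB.instance Definition _ := [Choice of partition by <:].

(* A square (i, j) lies in row i and column j, both counted from 0; row 0 is the
   first (top) row. *)
Definition square := (nat * nat)%type.
Definition shape := {fset square}.

Definition diagram (la : partition) : shape :=
  [fset c in [seq (i, j) | i <- iota 0 (size la), j <- iota 0 (nth 0%N la i)]]%fset.

Definition contained (mu la : partition) : bool :=
  (diagram mu `<=` diagram la)%fset.

Definition skew (la mu : partition) : shape := (diagram la `\` diagram mu)%fset.

Definition is_skew (D : shape) :=
  exists la mu : partition, contained mu la /\ D = skew la mu.

Definition adjacent : rel square := fun c d =>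
  [|| (c.1 == d.1) && ((c.2 == d.2.+1) || (d.2 == c.2.+1)) |
      (c.2 == d.2) && ((c.1 == d.1.+1) || (d.1 == c.1.+1))].

Definition connected_shape (D : shape) :=
  forall c d, c \in D -> d \in D ->
    exists p : seq square, [/\ {subset p <= D}, path adjacent c p & last c p = d].

Definition no_2x2 (D : shape) := forall i j,
  ~ [/\ (i, j) \in D, (i, j.+1) \in D, (i.+1, j) \in D & (i.+1, j.+1) \in D].

Definition is_ribbon (n : nat) (D : shape) :=
  [/\ is_skew D, connected_shape D, #|` D| = n & no_2x2 D].

Definition spin (D : shape) : nat := (#|` [fset c.1 | c in D]|%fset).-1.

Definition is_tiling (n : nat) (D : shape) (P : {fset shape}) :=
  [/\ forall B, B \in P -> is_ribbon n B,
      forall B C, B \in P -> C \in P -> B != C -> [disjoint B & C]%fset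
    & (\bigcup_(B <- P) B)%fset = D].

Definition is_topright (B : shape) (c : square) :=
  c \in B /\ forall d, d \in B -> (c.1 <= d.1)%N && (d.2 <= c.2)%N.

(* The upper side of the square [c] of [D] lies on the boundary of [D]. *)
Definition touches_north (D : shape) (c : square) :=
  c.1 = 0%N \/ (c.1.-1, c.2) \notin D.

Definition is_strip_tiling (n : nat) (mu la : partition) (P : {fset shape}) :=
  [/\ contained mu la, is_tiling n (skew la mu) P
    & forall B, B \in P ->
        exists2 c, is_topright B c & touches_north (skew la mu) c].

Definition is_horizontal_strip (n : nat) (mu la : partition) :=
  exists P, is_strip_tiling n mu la P.

(* The tiling of the strip [la / mu], which is unique if it exists. *)
Definition strip_tiling (n : nat) (mu la : partition) : {fset shape} :=
  xget fset0 [set P | is_strip_tiling n mu la P].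

(* The tableau given by the chain mu = mu^0, mu^1, ..., mu^r = la is represented
   by [T] = [:: mu^1; ...; mu^r]; [chain_steps mu T] lists the pairs
   (mu^(i-1), mu^i). *)
Definition chain_steps (mu : partition) (T : seq partition) :=
  zip (mu :: T) T.

(* The last condition says that the last strip is nonempty (or r = 0): chains
   that only differ by trailing empty strips are the same tableau, as otherwise
   each weight would be counted infinitely often. Other strips may be empty. *)
Definition is_ribbon_tableau (n : nat) (la mu : partition) (T : seq partition) :=
  [/\ forall p, p \in chain_steps mu T -> is_horizontal_strip n p.1 p.2,
      last mu T = la
    & last mu T \notin belast mu T].

Definition tableau_weight (n : nat) (mu : partition) (T : seq partition) : seq nat :=
  [seq #|` strip_tiling n p.1 p.2| | p <- chain_steps mu T].

Definition tableau_spin (n : nat) (mu : partition) (T : seq partition) : nat :=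
  (\sum_(p <- chain_steps mu T) \sum_(B <- strip_tiling n p.1 p.2) spin B)%N.

(** * Ribbon functions, over the coefficient ring Z[q] *)

Definition fps_q {V : choiceType} : fps {poly int} V := fps_const 'X.

(* The ribbon function of [la / mu] in the variables z_1 = [Z 0], z_2 = [Z 1], ... *)
Definition ribbon_function {V : choiceType} (n : nat) (Z : nat -> V)
    (la mu : partition) : fps {poly int} V :=
  fps_sum [set T | is_ribbon_tableau n la mu T] (fun T =>
    fps_q ^+ tableau_spin n mu T *
    \prod_(i < size T) fps_var (Z i) ^+ nth 0%N (tableau_weight n mu T) i).

Definition removes_ribbon (n : nat) (la mu : partition) :=
  contained mu la /\ is_ribbon n (skew la mu).

(* The result of removing n-ribbons until no longer possible, which does not
   depend on the choices. *)
Definition ncore (n : nat) (la : partition) : partition :=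
  xget la [set ka | clos_refl_trans_1n _ (removes_ribbon n) la ka /\
                    forall mu, ~ removes_ribbon n ka mu].

Definition is_ncore (n : nat) (la : partition) := ncore n la = la.

Definition core_ribbon_function {V : choiceType} (n : nat) (Z : nat -> V)
    (la : partition) : fps {poly int} V :=
  ribbon_function n Z la (ncore n la).

(* The two sets of variables: x_i is [xvar (i - 1)], y_j is [yvar (j - 1)]. *)
Definition xvar (i : nat) : nat + nat := inl i.
Definition yvar (j : nat) : nat + nat := inr j.

(* Main.v *)
From mathcomp Require Import zify ring.
Require Import Defs.

(* The partition la with at most N parts is encoded by beads at the positions
   la_i + N - 1 - i. Adding an n-ribbon moves a bead from h - n to an empty
   position h, its spin being the number of beads jumped over, and a horizontal
   ribbon strip is a sequence of such moves with increasing h. The weight of a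
   strip can thus be read from left to right by a transfer matrix whose state is
   the occupation of the last n positions. Let U(x) be the operator adding a
   strip, with weight x^(number of ribbons) q^spin, and let D(y) be the adjoint
   operator with variable y. The transfer matrices of D(y) U(x) and U(x) D(y) are
   intertwined, and comparing the values far left and far right gives
     D(y) U(x) = prod_(k < n) (1 - x y q^(2k))^-1 U(x) D(y).
   Since only the empty strip can be removed from a core delta, the generating
   function la |-> G_(la/delta)(y_1, ..., y_s) is therefore an eigenvector of the
   adjoint of U(x), with eigenvalue prod_j prod_(k < n) (1 - x y_j q^(2k))^-1;
   the identity follows by adding the variables x_i one at a time. Each
   coefficient only involves finitely many partitions and variables. *)

Set Implicit Arguments.
Unset Strict Implicit.
Unset Printing Implicit Defensive.

Import GRing.Theory.

(** * Beads of partitions *)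

Local Notation row la i := (nth 0%N (parts la) i).

(** On the diagonal of content [c], a skew shape [la / mu] occupies the rows from [cnt mu c] up to,
    but excluding, [cnt la c]. This turns the geometry of ribbons into inequalities between counting
    functions. The obstacle in the commutation relation is that [D(y) U(x)] is an infinite sum,
    while the words are finite. On the left, [n] padding beads make the initial state full. On the
    right, an infinite empty tail is replaced by the function [stationary], which must be fixed by
    reading an empty letter. When the states carry [U] other beads, the two leading beads either
    stay or both jump, with weight x q^U y q^U, whence P(U+1) = P(U) + x y q^(2U) P(U+1). This is
    the origin of the factors q^(2k); there are [n] of them because the full state has [n] beads. A
    finite empty tail gives the same result only up to terms of high order in x and y, so the
    relation is proved modulo an abstract order predicate [I] and then used for the coefficients
    dividing a fixed monomial. *)

Lemma row_antitone (la : partition) i j : i <= j -> row la j <= row la i.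
Proof.
case: la => s /= /andP[ss _] ij; case: (ltnP j (size s)) => js; last by rewrite nth_default.
have tr : transitive geq by move=> a b c ab bc; exact: leq_trans bc ab.
by apply: (sorted_leq_nth tr (fun x => leqnn x) 0 ss i j); rewrite ?inE ?(leq_ltn_trans ij js).
Qed.

Lemma row_gt0 (la : partition) i : (0 < row la i) = (i < size la).
Proof.
case: (ltnP i (size la)) => h; last by rewrite nth_default.
case: la h => s /= /andP[_ s0] h; rewrite lt0n; apply: contraNneq s0 => <-.
exact: mem_nth.
Qed.

Lemma eq_partition (la mu : partition) : (forall i, row la i = row mu i) -> la = mu.
Proof.
move=> h; apply: val_inj; apply: (@eq_from_nth _ 0) => [|i _]; last exact: h.
apply/eqP; rewrite eqn_leq; apply/andP; split; rewrite leqNgt -row_gt0.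
  by rewrite h row_gt0 ltnn.
by rewrite -h row_gt0 ltnn.
Qed.

Lemma in_diagram (la : partition) (x : square) : (x \in diagram la) = (x.2 < row la x.1).
Proof.
case: x => i j /=; rewrite /diagram !inE /=.
apply/allpairsPdep/idP => [[i' [j' [+ + [-> ->]]]]|h]; rewrite ?mem_iota //.
by exists i, j; split => //; rewrite mem_iota //= -row_gt0; apply: leq_ltn_trans h.
Qed.

Lemma in_skew (la mu : partition) (x : square) :
  (x \in skew la mu) = (row mu x.1 <= x.2 < row la x.1).
Proof. by rewrite /skew in_fsetD !in_diagram -leqNgt. Qed.

Lemma containedP (mu la : partition) :
  reflect (forall i, row mu i <= row la i) (contained mu la).
Proof.
apply: (iffP idP) => [/fsubsetP h i|h]; last first.
  apply/fsubsetP => -[i j].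
  by rewrite !in_diagram /= => /leq_trans; exact.
case: (posnP (row mu i)) => [->//|p].
have := h (i, (row mu i).-1); rewrite !in_diagram /= prednK //; exact.
Qed.

Lemma contained_anti mu la : contained mu la -> contained la mu -> mu = la.
Proof.
move=> /containedP h1 /containedP h2; apply: eq_partition => i.
by apply/eqP; rewrite eqn_leq h1 h2.
Qed.

Lemma leq_b2n (b c : bool) : (b -> c) -> (b : nat) <= c.
Proof. by case: b => // ->. Qed.

Section Beads.
Variable N : nat.

(* The beads of [la] are the positions [row la i + N - 1 - i], [i < N]; the
   diagonal of content [c] of the diagram is crossed between the beads at
   positions [< c] and those at positions [>= c]. *)
Definition bead_count (la : partition) (c : nat) : nat :=
  \sum_(i < N) (c <= row la i + (N - i.+1)).

Local Notation cnt := bead_count.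

Definition bead la t := cnt la t - cnt la t.+1.
Local Notation bd := bead.

(** Bead positions strictly decrease with the row, so the beads at positions [>= c] are those of an
    initial segment of rows. *)
Lemma ltn_cnt la i c : i < N -> (i < cnt la c) = (c <= row la i + (N - i.+1)).
Proof.
move=> iN; rewrite /bead_count; apply/idP/idP => [|h].
  apply: contraTT; rewrite -ltnNge -leqNgt => h.
  apply: (@leq_trans (\sum_(k < N | k < i) 1)); last first.
    by rewrite -(big_ord_widen N (fun _ => 1) (ltnW iN)) sum1_card card_ord.
  rewrite [X in _ <= X]big_mkcond; apply: leq_sum => k _; case: ifP => [_|]; first exact: leq_b1.
  move=> /negbT; rewrite -leqNgt => ik; have := row_antitone la ik; lia.
apply: (@leq_trans (\sum_(k < i.+1) 1)); first by rewrite sum1_card card_ord.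
rewrite (big_ord_widen N (fun _ => 1)) // [X in X <= _]big_mkcond; apply: leq_sum => k _.
case: ifP => // ki; rewrite lt0b; have := row_antitone la (ki : k <= i); lia.
Qed.

Lemma cnt_le la c : cnt la c <= N.
Proof.
rewrite -[X in _ <= X]card_ord -sum1_card; by apply: leq_sum => i _; exact: leq_b1.
Qed.

Lemma cnt_decr la c d : c <= d -> cnt la d <= cnt la c.
Proof. by move=> cd; apply: leq_sum => i _; apply: leq_b2n; lia. Qed.

(** Distinct rows have distinct bead positions, so at most one bead sits at [c]. *)
Lemma cntS_ge la c : cnt la c <= (cnt la c.+1).+1.
Proof.
rewrite leqNgt; apply/negP => h; have hN := leq_trans h (cnt_le la c).
have h1 := h; rewrite ltn_cnt // in h1.
have := ltn_cnt la c.+1 (ltnW hN); rewrite ltnn => /esym/negbT; rewrite -ltnNge.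
have := row_antitone la (leqnSn (cnt la c.+1)); lia.
Qed.

Lemma cntE la t : cnt la t = bd la t + cnt la t.+1.
Proof. by rewrite /bead subnK // cnt_decr. Qed.

Lemma bd_le1 la t : bd la t <= 1.
Proof. rewrite /bead; have := cntS_ge la t; lia. Qed.

Lemma cnt_ge la c : N - c <= cnt la c.
Proof.
case: (posnP (N - c)) => [->//|h].
rewrite -(prednK h) ltn_cnt; lia.
Qed.

Lemma cnt0 la : cnt la 0 = N.
Proof. by apply/eqP; rewrite eqn_leq cnt_le -{1}(subn0 N) cnt_ge. Qed.

(** Column minus row, shifted by [N] to stay a natural number on the first [N] rows. *)
Definition content (x : square) := x.2 + (N - x.1).
Local Notation ct := content.

Lemma in_diagram_cnt (la : partition) (x : square) : x.1 < N -> (x \in diagram la) = (x.1 < cnt la (ct x)).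
Proof.
case: x => i j /= iN; rewrite in_diagram ltn_cnt // /content /=.
by move: (row la i) => r; apply/idP/idP; lia.
Qed.

Lemma in_skew_cnt (la mu : partition) (x : square) : x.1 < N ->
  (x \in skew la mu) = (cnt mu (ct x) <= x.1 < cnt la (ct x)).
Proof. by move=> xN; rewrite /skew in_fsetD !in_diagram_cnt // -leqNgt. Qed.

Lemma row_ltN (la : partition) i j : size la <= N -> j < row la i -> i < N.
Proof.
by move=> sN h; apply: leq_trans sN; rewrite -row_gt0; apply: leq_ltn_trans h.
Qed.

Lemma contained_cntP (mu la : partition) : size mu <= N ->
  reflect (forall c, cnt mu c <= cnt la c) (contained mu la).
Proof.
move=> sN; apply: (iffP (containedP _ _)) => h.
  by move=> c; apply: leq_sum => i _; apply: leq_b2n; have := h i; lia.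
move=> i; case: (ltnP i N) => [iN|iN]; last by rewrite nth_default // (leq_trans sN).
have := ltn_cnt mu (row mu i + (N - i.+1)) iN; rewrite leqnn => h1.
by have := leq_trans h1 (h _); rewrite ltn_cnt //; lia.
Qed.

Lemma eq_cnt (mu la : partition) : size mu <= N -> size la <= N ->
  (forall c, cnt mu c = cnt la c) -> mu = la.
Proof.
move=> s1 s2 h.
by apply: contained_anti; apply/contained_cntP => // c; rewrite h.
Qed.

Lemma eq_bd T (mu la : partition) : size mu <= N -> size la <= N ->
  cnt mu T = 0 -> cnt la T = 0 -> (forall t, t < T -> bd mu t = bd la t) -> mu = la.
Proof.
move=> s1 s2 m0 l0 e; apply: (eq_cnt s1 s2) => c.
case: (leqP T c) => [Tc|/ltnW cT].
  have := cnt_decr mu Tc; have := cnt_decr la Tc; rewrite m0 l0 !leqn0.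
  by move=> /eqP-> /eqP->.
rewrite -(subKn cT); elim: (T - c) (leq_subr c T) => [|d IH] dT; first by rewrite subn0 m0 l0.
rewrite [LHS]cntE [RHS]cntE e; last by lia.
by rewrite subnSK // IH // ltnW.
Qed.

Lemma contained_size (mu la : partition) : contained mu la -> size mu <= size la.
Proof.
move=> /containedP h; rewrite leqNgt -row_gt0; apply/negP => h1.
have := leq_trans h1 (h _); by rewrite row_gt0 ltnn.
Qed.

Lemma bd_pad (la : partition) t : t + size la < N -> bd la t = 1.
Proof.
move=> h; have e c : c + size la <= N -> cnt la c = N - c.
  move=> cN; apply/eqP; rewrite eqn_leq cnt_ge andbT leqNgt; apply/negP => h1.
  have hN : N - c < N by apply: leq_trans h1 (cnt_le _ _).
  move: h1; rewrite ltn_cnt //; rewrite nth_default ?add0n; lia.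
rewrite /bead !e; lia.
Qed.

(* Realizes a counting function; row [i] has a box for each hole with more than
   [i] beads to its right. *)
Lemma ex_partition (k : nat -> nat) T :
  (forall c, k c.+1 <= k c <= (k c.+1).+1) -> k 0 = N -> k T = 0 ->
  exists2 la : partition, size la <= N & forall c, cnt la c = k c.
Proof.
move=> kS k0 kT.
have kd c d : c <= d -> k d <= k c.
  move=> /subnK <-; elim: (d - c) => // e; apply: leq_trans.
  by rewrite addSn; case/andP: (kS (e + c)).
have kT' c : T <= c -> k c = 0 by move=> /kd; rewrite kT leqn0 => /eqP.
pose f i := \sum_(t < T) ((k t == k t.+1) && (i < k t)).
have fd i j : i <= j -> f j <= f i.
  move=> ij; apply: leq_sum => t _; case: eqP => //= _.
  by case: (ltnP j (k t)) => // /(leq_ltn_trans ij) ->.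
have f0 i : N <= i -> f i = 0.
  move=> Ni; rewrite /f big1 // => t _.
  by rewrite [i < _]ltnNge (leq_trans _ Ni) ?andbF // -k0 kd.
have fE i c : i < N -> (i < k c) = (c <= f i + (N - i.+1)).
  move=> iN.
  (* If more than [i] beads are at or to the right of [m], the condition [i < k t] holds for every
     hole below [m], and there are [m - (N - k m)] such holes. *)
  have key : forall m, m <= T -> \sum_(t < m) ((k t == k t.+1) && (i < k t)) =
      if i < k m then m - (N - k m) else \sum_(t < m) ((k t == k t.+1) && (i < k t)).
    elim=> [|m IH] mT; first by rewrite big_ord0; case: ifP.
    case: ifP => // h; rewrite big_ord_recr /= IH; last lia.
    have := kS m; have km := kd _ _ (leq0n m); rewrite k0 in km.
    have : forall m, N - k m <= m.
      elim=> [|p]; first by rewrite k0 subnn.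
      by have := kS p; lia.
    move=> /(_ m); case: (ltnP i (k m)) => h1; case: eqP => /=; lia.
  (* [m] is the position of the bead of row [i]. *)
  have lastm : exists2 m, m < T & (i < k m) && (k m.+1 <= i).
    have : exists m, ~~ (i < k m) by exists T; rewrite kT.
    case/ex_minnP => -[|m]; first by rewrite k0 iN.
    move=> h1 h2; exists m; last first.
      apply/andP; split; last by rewrite leqNgt.
      by apply: contraT => /h2; rewrite ltnn.
    by apply: h2; rewrite kT.
  case: lastm => m mT /andP[h1 h2].
  have -> : f i = m - (N - k m).
    have := key m (ltnW mT); rewrite h1 => <-; rewrite /f.
    pose F t : nat := (k t == k t.+1) && (i < k t).
    rewrite -(big_mkord xpredT F) -(big_mkord xpredT F) (big_cat_nat (leq0n m.+1)) //=.
    rewrite big_nat_recr //= [F m]/F; have -> : (k m == k m.+1) = false by apply/eqP; lia.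
    have -> : \sum_(m.+1 <= t < T) F t = 0; last by rewrite !addn0.
    rewrite big_nat big1 // => t /andP[mt _].
    by rewrite /F [i < _]ltnNge (leq_trans (kd _ _ mt) h2) andbF.
  have := kS m => kSm.
  have mm : N - k m <= m.
    elim: (m) => [|p]; first by rewrite k0 subnn.
    by have := kS p; lia.
  have km := kd _ _ (leq0n m); rewrite k0 in km.
  apply/idP/idP => h; first by rewrite leqNgt; apply/negP => h3; have := kd m.+1 c; lia.
  by apply: leq_trans h1 (kd _ _ _); lia.
pose s := [seq x <- mkseq f N | 0 < x].
have srt : sorted geq (mkseq f N).
  apply/(sortedP 0) => i; rewrite size_mkseq => iN.
  by rewrite !nth_mkseq //; [apply: fd | apply: ltnW].
have tr : transitive geq by move=> a b c ab bc; exact: leq_trans bc ab.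
have ps : sorted geq s && (0 \notin s).
  by rewrite sorted_filter //= mem_filter.
(* The sequence is antitone, so discarding zeros only cuts a tail where [nth] returns 0 anyway. *)
have rowE i : nth 0 s i = f i.
  have gen : forall l, sorted geq l -> forall i, nth 0 [seq x <- l | 0 < x] i = nth 0 l i.
    elim=> [//|a l IH] /= pl [|j] /=.
      case: (posnP a) => [a0|//].
      suff -> : [seq x <- l | 0 < x] = [::] by [].
      apply/eqP; rewrite -(negbK (_ == _)) -has_filter; apply/hasPn => x xl.
      by have := allP (order_path_min tr pl) x xl; rewrite a0 /= leqn0 => /eqP->.
    case: (posnP a) => [a0|_] /=; last by rewrite IH // (path_sorted pl).
    have al x : x \in l -> x = 0.
      by move=> xl; have := allP (order_path_min tr pl) x xl; rewrite a0 /= leqn0 => /eqP.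
    have -> : [seq x <- l | 0 < x] = [::].
      by apply/eqP; rewrite -(negbK (_ == _)) -has_filter; apply/hasPn => x /al ->.
    rewrite nth_nil; case: (ltnP j (size l)) => jl; last by rewrite nth_default.
    by rewrite (al (nth 0 l j)) ?mem_nth.
  rewrite gen //; case: (ltnP i N) => iN; first by rewrite nth_mkseq.
  by rewrite nth_default ?size_mkseq // f0.
exists (Partition ps) => [|c].
  by rewrite /= (leq_trans (size_subseq (filter_subseq _ _))) ?size_mkseq.
apply/eqP; rewrite eqn_leq; apply/andP; split; rewrite leqNgt; apply/negP => h.
  have iN := leq_trans h (cnt_le _ _); move: h; rewrite ltn_cnt //= rowE -fE // ltnn //.
have iN : cnt (Partition ps) c < N.
  by apply: leq_trans h _; rewrite -k0 kd.
by move: h; rewrite fE // -rowE -[nth 0 s _]/(row (Partition ps) _) -ltn_cnt // ltnn.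
Qed.

End Beads.

(** * Ribbons as bead moves *)

Lemma seq_max (T : eqType) (f : T -> nat) (s : seq T) x0 : x0 \in s ->
  exists2 x, x \in s & forall y, y \in s -> f y <= f x.
Proof.
move=> x0s; have h : exists k, has (fun x => f x == k) s.
  by exists (f x0); apply/hasP; exists x0.
have b k : has (fun x => f x == k) s -> k <= \max_(x <- s) f x.
  by case/hasP => x xs /eqP <-; exact: leq_bigmax_seq.
case: (ex_maxnP h b) => k /hasP[x xs /eqP xk] km; exists x => // y ys.
by rewrite xk; apply: km; apply/hasP; exists y.
Qed.

Lemma seq_min (T : eqType) (f : T -> nat) (s : seq T) x0 : x0 \in s ->
  exists2 x, x \in s & forall y, y \in s -> f x <= f y.
Proof.
move=> x0s; have h : exists k, has (fun x => f x == k) s.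
  by exists (f x0); apply/hasP; exists x0.
case: (ex_minnP h) => k /hasP[x xs /eqP xk] km; exists x => // y ys.
by rewrite xk; apply: km; apply/hasP; exists y.
Qed.

Lemma card_fimage (f : square -> nat) (B : shape) : {in B &, injective f} ->
  #|` [fset f x | x in B]%fset| = #|` B|.
Proof. by move=> h; rewrite card_in_imfset. Qed.

Section Ribbons.
Variables (N n : nat).
Local Notation cnt := (bead_count N).
Local Notation ct := (content N).

Definition cell_at t i : square := (i, t + i - N).
Local Notation cell := cell_at.

Lemma ct_cell t i : i <= N -> N <= t + i -> ct (cell t i) = t.
Proof. by rewrite /content /=; lia. Qed.

Lemma cell_ct (x : square) : x.1 < N -> cell (ct x) x.1 = x.
Proof. by case: x => i j /= iN; rewrite /cell_at /content /=; congr (_, _); lia. Qed.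

Lemma ct_inj (x y : square) : x.1 < N -> ct x = ct y -> x.1 = y.1 -> x = y.
Proof. by move=> xN e e1; rewrite -(cell_ct xN) e e1 cell_ct -?e1. Qed.

(* [B] is the ribbon with contents in (h - n, h] whose square of content t lies
   in row [R t]. *)
Record ribbon_at h (R : nat -> nat) (B : shape) : Prop := RibbonAt {
  rib_h : 0 < n <= h;
  rib_R : forall t, h - n < t <= h -> R t < N /\ N <= t + R t;
  rib_B : forall x : square, x \in B ->
    [/\ x.1 < N, h - n < ct x <= h & x.1 = R (ct x)];
  rib_in : forall t, h - n < t <= h -> cell t (R t) \in B;
  rib_step : forall t, h - n < t < h -> R t.+1 <= R t <= (R t.+1).+1
}.
Local Notation rib := ribbon_at.

Lemma adjacent_ct (x y : square) : adjacent x y -> x.1 < N -> y.1 < N ->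
  (ct y = (ct x).+1 /\ y.1 <= x.1 <= y.1.+1) \/
  (ct x = (ct y).+1 /\ x.1 <= y.1 <= x.1.+1).
Proof.
case: x y => [i j] [i' j']; rewrite /adjacent /content /=.
by move=> /orP[/andP[/eqP a /orP[] /eqP b]|/andP[/eqP a /orP[] /eqP b]] iN iN'; lia.
Qed.

(** Contents of adjacent squares differ by one, so a path cannot skip a content. *)
Lemma ivt_path (B : shape) (x : square) p t : (forall y : square, y \in B -> y.1 < N) ->
  x \in B -> {subset p <= B} -> path adjacent x p -> ct x <= t < ct (last x p) ->
  exists y z : square, [/\ y \in B, z \in B, adjacent y z, ct y = t & ct z = t.+1].
Proof.
move=> BN; elim: p x => [|y p IH] x /= xB pB; first by lia.
move=> /andP[xy py] ht.
have yB : y \in B by apply: pB; rewrite inE eqxx.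
case: (leqP (ct y) t) => h.
  by apply: (IH y) => //; [move=> z zp; apply: pB; rewrite inE zp orbT | case/andP: ht => _ ->; rewrite h].
by exists x, y; have := adjacent_ct xy (BN _ xB) (BN _ yB); split=> //; lia.
Qed.

(** Two squares on one diagonal would, by convexity of skew shapes, force a 2x2 square. So the
    content is injective on a ribbon; by connectedness its values form an interval, of length
    [n]. *)
Lemma ribbon_rib B : 0 < n -> is_ribbon n B -> (forall y : square, y \in B -> y.1 < N) ->
  exists h R, rib h R B.
Proof.
move=> n_gt0 [[la [mu [_ eB]]] conn cardB no22] BN.
have convex (x y z : square) : x \in B -> y \in B -> x.1 <= z.1 <= y.1 -> x.2 <= z.2 <= y.2 -> z \in B.
  rewrite eB !in_skew => /andP[h1 _] /andP[_ h2] /andP[a b] /andP[c d].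
  have := row_antitone mu a; have := row_antitone la b; lia.
have inj (x y : square) : x \in B -> y \in B -> ct x = ct y -> x = y.
  suff wl (x' y' : square) : x' \in B -> y' \in B -> ct x' = ct y' -> x'.1 <= y'.1 -> x' = y'.
    move=> xB yB e; case: (leqP x.1 y.1) => [/wl|/ltnW/wl]; first exact.
    by move=> h; apply/esym/h.
  move=> xB yB e; rewrite leq_eqVlt => /orP[/eqP e1|lt1].
    by apply: ct_inj => //; exact: BN.
  have := BN _ yB; have := BN _ xB.
  case: x' y' xB yB e lt1 => i j [i' j'] xB yB; rewrite /content /= => e lt1 iN i'N.
  exfalso; apply: (no22 i j); split=> //; apply: (convex (i, j) (i', j')) => //=; lia.
have [x0 x0B] : exists x0, x0 \in B.
  by apply/fset0Pn; rewrite -cardfs_gt0 cardB.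
have [xm xmB xmax] := seq_max ct x0B; have [xe xeB xmin] := seq_min ct x0B.
set h := ct xm in xmax; set e := ct xe in xmin.
have e1 : 0 < e by have := BN _ xeB; rewrite /e /content; lia.
have eh : e <= h by apply: xmin.
have adj t : e <= t < h -> exists y z : square, [/\ y \in B, z \in B, adjacent y z, ct y = t & ct z = t.+1].
  move=> ht; have [p [pB px lx]] := conn _ _ xeB xmB.
  by apply: (ivt_path BN xeB pB px); rewrite lx.
have ex t : e <= t <= h -> exists2 x : square, x \in B & ct x = t.
  case/andP=> et; rewrite leq_eqVlt => /orP[/eqP->|th]; first by exists xm.
  by have [|y [z [? _ _ ? _]]] := adj t; [rewrite et | exists y].
have hn : (h - e).+1 = n.
  rewrite -cardB -(@card_fimage ct) //.
  transitivity (#|` [fset t in iota e (h - e).+1]|)%fset.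
    by rewrite card_fseq undup_id ?iota_uniq // size_iota.
  congr #|` _|; apply/fsetP => t; rewrite !inE mem_iota.
  apply/idP/imfsetP => [ht|[x /= xB ->]].
    by have [|x xB <-] := ex t; [lia | exists x].
  by have := xmax _ xB; have := xmin _ xB; lia.
pose R t := (head (0, 0) [seq x <- B | ct x == t]).1.
have RE (x : square) : x \in B -> R (ct x) = x.1.
  move=> xB; rewrite /R; case E : [seq _ <- _ | _] => [|y s] /=.
    have : x \in [seq x0 <- B | ct x0 == ct x] by rewrite mem_filter eqxx.
    by rewrite E.
  have : y \in [seq x0 <- B | ct x0 == ct x] by rewrite E inE eqxx.
  by rewrite mem_filter => /andP[/eqP e2 yB]; rewrite (inj y x).
exists h, R; split.
- by lia.
- move=> t ht; have [|x xB xt] := ex t; first by lia.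
  rewrite -xt RE //; have := BN _ xB; rewrite /content; lia.
- by move=> x xB; split; [exact: BN | have := xmax _ xB; have := xmin _ xB; lia | rewrite RE].
- move=> t ht; have [|x xB xt] := ex t; first by lia.
  by rewrite -xt RE // cell_ct // BN.
- move=> t ht; have [|y [z [yB zB yz yt zt]]] := adj t; first by lia.
  by rewrite -zt -yt !RE //; have := adjacent_ct yz (BN _ yB) (BN _ zB); lia.
Qed.

Section Rib.
Variables (h : nat) (R : nat -> nat) (B : shape).
Hypothesis ribB : rib h R B.

Lemma rib_anti s t : h - n < s -> s <= t -> t <= h -> R t <= R s.
Proof.
move=> hs st th; rewrite -(subnKC st) in th *; elim: (t - s) th => [|d IH] th.
  by rewrite addn0.
have := rib_step ribB (t := s + d); rewrite addnS in th *; move: IH; lia.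
Qed.

Lemma rib_rows i : R h <= i <= R (h - n).+1 ->
  exists2 t, h - n < t <= h & R t = i.
Proof.
have hn := rib_h ribB.
suff: forall d, d < n -> R h <= i <= R (h - d) -> exists2 t, h - n < t <= h & R t = i.
  by move=> /(_ n.-1); rewrite (_ : h - n.-1 = (h - n).+1); [move=> H; apply: H; lia | lia].
elim=> [|d IH] dn hi; first by rewrite subn0 in hi; exists h; lia.
case: (leqP i (R (h - d))) => hd; first by apply: IH; lia.
exists (h - d.+1); first lia.
have := rib_step ribB (t := h - d.+1); rewrite (_ : (h - d.+1).+1 = h - d); lia.
Qed.

(** The row changes by at most one between consecutive contents, so the rows met fill the interval
    between the two end rows. *)
Lemma spin_rib : spin B = R (h - n).+1 - R h.
Proof.
have hn := rib_h ribB.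
rewrite /spin (_ : [fset x.1 | x in B]%fset =
   [fset i in iota (R h) (R (h - n).+1 - R h).+1]%fset).
  by rewrite card_fseq undup_id ?iota_uniq // size_iota.
apply/fsetP => i; rewrite !inE mem_iota; apply/imfsetP/idP => [[x /= xB ->]|hi].
  have [_ hx ->] := rib_B ribB xB.
  have a : R (ct x) <= R (h - n).+1 by apply: rib_anti; lia.
  have b : R h <= R (ct x) by apply: rib_anti; lia.
  lia.
have b : R h <= R (h - n).+1 by apply: rib_anti; lia.
have [|t ht <-] := @rib_rows i; first lia.
by exists (cell t (R t)) => //; apply: (rib_in ribB).
Qed.

Lemma rib_cell_ct t : h - n < t <= h -> ct (cell t (R t)) = t.
Proof. by move=> /(rib_R ribB)[h1 h2]; rewrite ct_cell // ltnW. Qed.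

Lemma rib_eq (x : square) t : x \in B -> ct x = t -> x = cell t (R t).
Proof.
by move=> xB <-; have [xN _ <-] := rib_B ribB xB; rewrite cell_ct.
Qed.

Lemma rib_card : #|` B| = n.
Proof.
have hn := rib_h ribB.
rewrite -(@card_fimage ct); last first.
  move=> x y xB yB e; have [xN _ ex] := rib_B ribB xB; have [yN _ ey] := rib_B ribB yB.
  by apply: ct_inj; rewrite // ex ey e.
rewrite (_ : [fset ct x | x in B]%fset = [fset t in iota (h - n).+1 n]%fset).
  by rewrite card_fseq undup_id ?iota_uniq // size_iota.
apply/fsetP => t; rewrite !inE mem_iota; apply/imfsetP/idP => [[x /= xB ->]|ht].
  by have [_ hx _] := rib_B ribB xB; lia.
exists (cell t (R t)) => /=; first by apply: (rib_in ribB); lia.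
by rewrite rib_cell_ct //; lia.
Qed.

Lemma adjacent_sym (x y : square) : adjacent x y = adjacent y x.
Proof. by rewrite /adjacent; case: x y => [a b] [c d] /=; apply/idP/idP; lia. Qed.

Lemma rib_adj t : h - n < t < h -> adjacent (cell t (R t)) (cell t.+1 (R t.+1)).
Proof.
move=> ht; have := rib_step ribB ht; have [|a b] := rib_R ribB (t := t); first lia.
have [|c d] := rib_R ribB (t := t.+1); first lia.
by rewrite /adjacent /cell_at /=; lia.
Qed.

Lemma rib_connected : connected_shape B.
Proof.
have up s t : h - n < s -> s <= t -> t <= h -> exists p, [/\ {subset p <= B},
   path adjacent (cell s (R s)) p & last (cell s (R s)) p = cell t (R t)].
  move=> hs st; rewrite -(subnKC st); elim: (t - s) => [|d IH] th.
    by exists [::]; rewrite addn0.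
  have [|p [pB pp lp]] := IH; first lia.
  exists (rcons p (cell (s + d.+1) (R (s + d.+1)))); split.
  - move=> x; rewrite mem_rcons inE => /orP[/eqP->|/pB//]; apply: (rib_in ribB) => //; lia.
  - by rewrite rcons_path pp lp addnS rib_adj //; lia.
  - by rewrite last_rcons.
have down s t : h - n < s -> s <= t -> t <= h -> exists p, [/\ {subset p <= B},
   path adjacent (cell t (R t)) p & last (cell t (R t)) p = cell s (R s)].
  move=> hs st; rewrite -(subnKC st); elim: (t - s) => [|d IH] th.
    by exists [::]; rewrite addn0.
  have [|p [pB pp lp]] := IH; first lia.
  exists (cell (s + d) (R (s + d)) :: p); split=> //=.
  - move=> x; rewrite inE => /orP[/eqP->|/pB//]; apply: (rib_in ribB) => //; lia.
  - by rewrite pp andbT adjacent_sym addnS rib_adj //; lia.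
move=> x y xB yB; have [xN hx ex] := rib_B ribB xB; have [yN hy ey] := rib_B ribB yB.
rewrite -(cell_ct xN) -(cell_ct yN) ex ey.
case: (leqP (ct x) (ct y)) => [xy|/ltnW yx].
  by apply: up => //; lia.
by apply: down => //; lia.
Qed.

End Rib.

(** Moving a bead from [h - n] to [h] raises by one exactly the counts at [c] in [(h - n, h]]. *)
Definition adds_ribbon h (mu la : partition) := [/\ 0 < n <= h, size mu <= N, size la <= N &
  forall c, cnt la c = cnt mu c + (h - n < c <= h)].
Local Notation mv := adds_ribbon.

Lemma mv_contained h mu la : mv h mu la -> contained mu la.
Proof. by case=> _ s _ e; apply/(contained_cntP _ s) => c; rewrite e leq_addr. Qed.

(** The counts differ by one on the diagonals of the interval and agree elsewhere, so each of these
    diagonals carries one square of the skew shape, just below [mu]. *)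
Lemma mv_rib h mu la : mv h mu la -> rib h (cnt mu) (skew la mu).
Proof.
case=> nh s1 s2 e; split=> //.
- move=> t ht; have := cnt_ge N mu t; have := cnt_le N la t; rewrite e ht; lia.
- move=> x xB; have xN : x.1 < N.
    by move: xB; rewrite in_skew => /andP[_ /(row_ltN s2)].
  move: xB; rewrite (in_skew_cnt la mu xN) e.
  by case: (h - n < ct x <= h) => h3; split=> //; lia.
- move=> t ht; have := cnt_ge N mu t; have := cnt_le N la t; rewrite e ht => h1 h2.
  have [a b] : cnt mu t < N /\ N <= t + cnt mu t by lia.
  by rewrite (@in_skew_cnt N) // ct_cell ?(ltnW a) // e ht addn1 leqnn ltnSn.
- by move=> t ht; rewrite cntS_ge cnt_decr.
Qed.

Lemma mv_ribbon h mu la : mv h mu la -> is_ribbon n (skew la mu).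
Proof.
move=> m; have r := mv_rib m; split.
- by exists la, mu; split=> //; apply: mv_contained m.
- exact: rib_connected r.
- exact: rib_card r.
(* Opposite corners of a 2x2 square have the same content but different rows. *)
move=> i j [h1 _ _ h2]; have [iN _ e1] := rib_B r h1; have [iN' _ e2] := rib_B r h2.
have : ct (i, j) = ct (i.+1, j.+1) by rewrite /content /=; move: iN' => /=; lia.
by move=> e; move: e1 e2; rewrite e /=; lia.
Qed.

(** The difference counts the beads strictly between [h - n] and [h], which are those jumped
    over. *)
Lemma mv_spin h mu la : mv h mu la ->
  spin (skew la mu) = cnt mu (h - n).+1 - cnt mu h.
Proof. by move=> m; exact: (spin_rib (mv_rib m)). Qed.

Lemma ex_mv h (mu : partition) : 0 < n <= h -> size mu <= N -> bead N mu (h - n) = 1 -> bead N mu h = 0 ->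
  exists la, mv h mu la.
Proof.
move=> nh s b1 b0.
have [T hT] : exists T, cnt mu T = 0 /\ h < T.
  exists (maxn h.+1 (row mu 0 + N)); split; last lia.
  apply/eqP; rewrite -leqn0 leqNgt; apply/negP => h1.
  have N0 : 0 < N by apply: leq_trans h1 (cnt_le _ _ _).
  by move: h1; rewrite ltn_cnt //; lia.
have [| | |la sla e] := @ex_partition N (fun c => cnt mu c + (h - n < c <= h)) T.
- move=> c; have := cntE N mu c; have := bd_le1 N mu c.
  case: (eqVneq c (h - n)) => [->|c1]; first by rewrite b1; lia.
  case: (eqVneq c h) => [->|c2]; first by rewrite b0; lia.
  lia.
- by rewrite cnt0 addn0.
- by case: hT => -> hT; lia.
by exists la.
Qed.

End Ribbons.

(** * Horizontal ribbon strips as bead moves with increasing heads *)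

Section Strips.
Variables (N n : nat).
Hypothesis n_gt0 : 0 < n.
Local Notation cnt := (bead_count N).
Local Notation ct := (content N).
Local Notation rib := (ribbon_at N n).
Local Notation cell := (cell_at N).
Local Notation mv := (adds_ribbon N n).

(* [bead_strip b mu la k s]: [la] arises from [mu] by adding [k] ribbons of total
   spin [s], with increasing head contents, all [>= b]. *)
Inductive bead_strip : nat -> partition -> partition -> nat -> nat -> Prop :=
| bead_strip0 b mu : bead_strip b mu mu 0 0
| bead_stripS b h mu mu' la k s : b <= h -> mv h mu mu' ->
    bead_strip h.+1 mu' la k s ->
    bead_strip b mu la k.+1 (cnt mu (h - n).+1 - cnt mu h + s).

Local Notation bstrip := bead_strip.

Definition head_ct (B : shape) := \max_(x <- B) ct x.

Lemma head_ctE h R B : rib h R B -> head_ct B = h.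
Proof.
move=> r; apply/eqP; rewrite eqn_leq; apply/andP; split.
  by apply/bigmax_leqP_seq => x xB _; have [_ /andP[]] := rib_B r xB.
have hh : h - n < h <= h by have := rib_h r; lia.
rewrite -{1}(rib_cell_ct r hh); apply: leq_bigmax_seq => //.
exact: (rib_in r).
Qed.

Lemma rib_ext h R R' B B' : rib h R B -> rib h R' B' ->
  (forall t, h - n < t <= h -> R t = R' t) -> B = B'.
Proof.
move=> r r' e; apply/fsetP => x; apply/idP/idP => xB.
  have [xN hx _] := rib_B r xB; rewrite (rib_eq r xB erefl) e //.
  exact: (rib_in r').
have [xN hx _] := rib_B r' xB; rewrite (rib_eq r' xB erefl) -e //.
exact: (rib_in r).
Qed.

Lemma rib_topright h R B (c : square) : rib h R B -> is_topright B c -> c = cell h (R h).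
Proof.
move=> r [cB top]; apply: (rib_eq r cB).
have hh : h - n < h <= h by have := rib_h r; lia.
have [cN hc _] := rib_B r cB.
have := top _ (rib_in r hh); have := rib_cell_ct r hh; have [a b] := rib_R r hh.
by move: hc; rewrite /content /=; lia.
Qed.

Lemma rib_anti2 h R B s t : rib h R B -> h - n < s -> s <= t -> t <= h -> s + R s <= t + R t.
Proof.
move=> r hs st th; rewrite -(subnKC st) in th *; elim: (t - s) th => [|d IH] th.
  by rewrite addn0.
have := rib_step r (t := s + d); rewrite addnS in th *; move: IH; lia.
Qed.

(** As the content grows along a ribbon, rows weakly decrease ([rib_anti]) and columns weakly
    increase ([rib_anti2]). *)
Lemma topright_rib h R B : rib h R B -> is_topright B (cell h (R h)).
Proof.
move=> r; have hh : h - n < h <= h by have := rib_h r; lia.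
split; first exact: (rib_in r).
move=> d dB; have [dN hd ed] := rib_B r dB.
have a : R h <= R (ct d) by apply: (rib_anti r); lia.
have b : ct d + R (ct d) <= h + R h by apply: (rib_anti2 r); lia.
have [u v] := rib_R r hh.
by move: a b; rewrite -ed /= {1}/content; lia.
Qed.

Section OneStrip.
Variables (mu la : partition) (P : {fset shape}).
Hypothesis sla : size la <= N.
Hypothesis tP : is_strip_tiling n mu la P.

Lemma skew_row (x : square) (mu' : partition) : x \in skew la mu' -> x.1 < N.
Proof. by rewrite in_skew => /andP[_ /(row_ltN sla)]. Qed.

Lemma tileP x : reflect (exists2 B, B \in P & x \in B) (x \in skew la mu).
Proof.
case: tP => _ [_ _ <-] _; apply: (iffP (bigfcupP _ _ _ _)) => [[B]|[B BP xB]].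
  by rewrite andbT; exists B.
by exists B; rewrite ?BP.
Qed.

Lemma tile_rib B : B \in P -> exists R, rib (head_ct B) R B.
Proof.
move=> BP; case: tP => _ [rb _ _] _.
have [|h [R r]] := ribbon_rib n_gt0 (rb _ BP) (N := N).
  by move=> y yB; apply: (@skew_row y mu); apply/tileP; exists B.
by exists R; rewrite (head_ctE r).
Qed.

Lemma tile_disj B C x : B \in P -> C \in P -> x \in B -> x \in C -> B = C.
Proof.
move=> BP CP xB xC; apply/eqP; apply: contraT => BC.
case: tP => _ [_ disj _] _; have /fdisjointP := disj _ _ BP CP BC.
by move=> /(_ x xB); rewrite xC.
Qed.

Lemma cell_skew t i (mu' : partition) : i < N -> N <= t + i ->
  (cell t i \in skew la mu') = (cnt mu' t <= i < cnt la t).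
Proof. by move=> iN ti; rewrite (@in_skew_cnt N) // ct_cell // ltnW. Qed.

Lemma tile_cell B h R t : B \in P -> rib h R B -> h - n < t <= h ->
  cnt mu t <= R t < cnt la t.
Proof.
move=> BP r ht; have [a b] := rib_R r ht.
by rewrite -cell_skew //; apply/tileP; exists B; rewrite // (rib_in r).
Qed.

(** The square above the head has content [h + 1]. If it is outside [mu], touching the northern edge
    means that it is outside [la] as well. *)
Lemma tile_north B h R : B \in P -> rib h R B ->
  cnt mu h.+1 < R h -> cnt la h.+1 < R h.
Proof.
move=> BP r lt1; case: tP => _ _ /(_ B BP)[c top].
have hh : h - n < h <= h by have := rib_h r; lia.
have [a b] := rib_R r hh.
rewrite (rib_topright r top); case=> /=; first lia.
have -> : ((R h).-1, h + R h - N) = cell h.+1 (R h).-1.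
  by rewrite /cell_at; congr (_, _); lia.
by rewrite cell_skew; lia.
Qed.

(* Ribbons do not cross, so a square of another ribbon above [B] would force a
   square of that ribbon on the diagonal of the head of [B], above it. *)
Lemma min_tile_rim B h R : B \in P -> rib h R B ->
  (forall C, C \in P -> h <= head_ct C) ->
  forall t, h - n < t <= h -> R t = cnt mu t.
Proof.
move=> BP r hmin t ht; have /andP[lo hi] := tile_cell BP r ht.
apply/eqP; rewrite eqn_leq lo andbT leqNgt; apply/negP => lt1.
have [a b] := rib_R r ht; have cg := cnt_ge N mu t.
have : cell t (R t).-1 \in skew la mu by rewrite cell_skew; lia.
case/tileP => C CP yC; have [RC rC] := tile_rib CP.
have ctt : ct (cell t (R t).-1) = t by rewrite ct_cell; lia.
have [_ hC eC] := rib_B rC yC; rewrite ctt /= in hC eC.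
have hhC := hmin C CP.
have BC : B <> C.
  by move=> e; rewrite -e in yC; have [_ _] := rib_B r yC; rewrite ctt /=; lia.
(* Rows change by at most one per diagonal, so [C] could stop being above [B] only by sharing a
   square with it. *)
have key u : t + u <= h -> RC (t + u) < R (t + u).
  elim: u => [|u IH] hu; first by rewrite addn0; lia.
  have := rib_step r (t := t + u); have := rib_step rC (t := t + u).
  have := IH; rewrite addnS in hu *.
  case: (eqVneq (RC (t + u).+1) (R (t + u).+1)) => [e|]; last by lia.
  case: BC; apply: (@tile_disj _ _ (cell (t + u).+1 (R (t + u).+1))) => //.
    by apply: (rib_in r); lia.
  by rewrite -e; apply: (rib_in rC); lia.
have := key (h - t); rewrite subnKC; last by lia.
move=> /(_ (leqnn _)) lt2.
have hh : h - n < h <= h by lia.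
have /andP[l1 l2] := tile_cell BP r hh.
have /andP[l3 l4] : cnt mu h <= RC h < cnt la h.
  by apply: (tile_cell CP rC); lia.
(* Since [cnt mu h.+1 <= RC h < R h], [tile_north] yields [cnt la h.+1 < R h < cnt la h], a drop by
   at least two. *)
have := tile_north BP r; have := cntS_ge N la h; have := cnt_decr N mu (leqnSn h); lia.
Qed.

Lemma min_tile_mv B h R : B \in P -> rib h R B ->
  (forall C, C \in P -> h <= head_ct C) ->
  exists mu', [/\ mv h mu mu', B = skew mu' mu & contained mu' la].
Proof.
move=> BP r hmin; have rim := min_tile_rim BP r hmin.
have nh := rib_h r; have hh : h - n < h <= h by lia.
have contl : contained mu la by case: tP.
have smu : size mu <= N by apply: leq_trans sla; exact: contained_size.
have b0 : bead N mu h = 0.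
  have := tile_north BP r; rewrite (rim h hh).
  have /andP[_] := tile_cell BP r hh; rewrite rim //.
  by have := cntS_ge N la h; rewrite /bead; lia.
(* Without a bead at [h - n], the first square outside [mu] on that diagonal lies in [la], and the
   tile containing it would have a head below [h]. *)
have b1 : bead N mu (h - n) = 1.
  have := bd_le1 N mu (h - n); have := cntE N mu (h - n).
  case: (posnP (bead N mu (h - n))) => [->|]; last lia.
  rewrite add0n => e _; exfalso.
  have h1 : h - n < (h - n).+1 <= h by lia.
  have /andP[_ up] := tile_cell BP r h1; rewrite rim // -e in up.
  have up2 := leq_trans up (cnt_decr N la (leqnSn (h - n))).
  have cl := cnt_le N la (h - n); have cg := cnt_ge N mu (h - n).
  have : cell (h - n) (cnt mu (h - n)) \in skew la mu.
    by rewrite cell_skew ?leqnn ?up2; lia.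
  case/tileP => C CP yC; have [RC rC] := tile_rib CP.
  have [_ + _] := rib_B rC yC; rewrite ct_cell; [|lia..].
  by have := hmin C CP; lia.
have [mu' m] := ex_mv nh smu b1 b0; exists mu'; split=> //.
  by apply: (rib_ext r (mv_rib m)) => t; apply: rim.
case: m => _ s1 s2 e; apply/(contained_cntP _ s2) => c; rewrite e.
case hc: (h - n < c <= h); last by rewrite addn0; move: c {hc}; apply/(contained_cntP _ smu).
by have := tile_cell BP r hc; rewrite rim //; lia.
Qed.

End OneStrip.

Lemma skewD (mu mu' la : partition) : contained mu mu' ->
  skew la mu' = (skew la mu `\` skew mu' mu)%fset.
Proof.
move=> /containedP c; apply/fsetP => x; rewrite in_fsetD !in_skew.
by have := c x.1; case: x => i j /= h; apply/idP/idP; lia.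
Qed.

(** Tiles are peeled off by increasing head content; [min_tile_mv] makes each of them a bead
    move. *)
Lemma strip_tiling_bstrip b (mu la : partition) P : size la <= N -> is_strip_tiling n mu la P ->
  (forall B, B \in P -> b <= head_ct B) ->
  bstrip b mu la #|` P| (\sum_(B <- P) spin B).
Proof.
move=> sla; move: {2}#|` P| (erefl #|` P|) => m.
elim: m b mu P => [|m IH] b mu P cP tP hb.
  have P0 : P = fset0 by apply/eqP; rewrite -cardfs_eq0 cP.
  subst P; rewrite cardfs0 big_seq_fset0.
  suff -> : la = mu by exact: bead_strip0.
  apply: contained_anti; last by case: tP.
  apply/fsubsetP => x xla; apply: contraT => xmu.
  have /(tileP tP)[B] : x \in skew la mu by rewrite /skew in_fsetD xmu.
  by rewrite inE.
have [B0 B0P] : exists B, B \in P by apply/fset0Pn; rewrite -cardfs_gt0 cP.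
have [B BP hmin] := seq_min head_ct B0P.
have [R r] := tile_rib sla tP BP.
have [mu' [m' eB cl]] := min_tile_mv sla tP BP r hmin.
have cm := mv_contained m'.
have sD := skewD la cm; rewrite -eB in sD.
have sB : spin B = cnt mu (head_ct B - n).+1 - cnt mu (head_ct B) by rewrite {1}eB (mv_spin m').
rewrite (cardfsD1 B) BP add1n (big_fsetD1 B) //= sB.
have disj C x : C \in (P `\ B)%fset -> x \in C -> x \notin B.
  rewrite in_fsetD1 => /andP[CB CP] xC; apply: contra CB => xB.
  by rewrite (tile_disj tP CP BP xC xB).
apply: (bead_stripS _ m').
  exact: hb.
apply: IH.
- by move: cP; rewrite (cardfsD1 B) BP add1n => -[].
- case: (tP) => _ [t1 t2 t3] t4; split=> //; first split.
  + by move=> C; rewrite in_fsetD1 => /andP[_]; exact: t1.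
  + by move=> C C'; rewrite !in_fsetD1 => /andP[_ CP] /andP[_ CP']; exact: t2.
  + apply/fsetP => x; rewrite sD in_fsetD; apply/bigfcupP/andP.
      case=> C; rewrite andbT => CP xC; split; first exact: (disj C).
      by apply/(tileP tP); exists C => //; move: CP; rewrite in_fsetD1 => /andP[].
    case=> xB /(tileP tP)[C CP xC]; exists C => //.
    by rewrite andbT in_fsetD1 CP andbT; apply: contraNneq xB => <-.
  + move=> C; rewrite in_fsetD1 => /andP[_ /t4[c top tn]]; exists c => //.
    case: tn => [|tn]; [by left | right].
    by rewrite sD in_fsetD negb_and tn orbT.
(* Two tiles sharing the minimal head would both follow the rim of [mu] and coincide, so the next
   head is strictly larger. *)
- move=> C; rewrite in_fsetD1 => /andP[CB CP].
  rewrite ltn_neqAle hmin // andbT; apply: contra CB => /eqP e.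
  have [RC rC] := tile_rib sla tP CP.
  have rim := min_tile_rim sla tP BP r hmin.
  have rimC := min_tile_rim sla tP CP rC.
  rewrite -e in rC rimC; apply/eqP; apply: (rib_ext rC r) => t ht.
  by rewrite rim // rimC.
Qed.

Lemma bstrip_strip_tiling b mu la k s : bstrip b mu la k s ->
  exists2 P, is_strip_tiling n mu la P &
    forall B, B \in P -> exists h R, b <= h /\ rib h R B.
Proof.
elim=> {b mu la k s} [b mu|b h mu mu' la k s bh m _ [P tP hP]].
  exists fset0 => //; split; [exact/containedP| |by []].
  split=> //; rewrite big_seq_fset0; apply/fsetP => x.
  by rewrite in_skew inE; case: ltnP => //; rewrite ?andbF // => h1; rewrite leqNgt h1.
have r := mv_rib m; have cm := mv_contained m.
have [t0 [t1 t2 t3] t4] := tP.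
have sD := skewD la cm; set B := skew mu' mu in r sD.
have cl : contained mu la.
  by apply/containedP => i; apply: leq_trans (containedP _ _ t0 i); exact: (containedP _ _ cm).
have sub x : x \in B -> x \in skew la mu.
  rewrite !in_skew => /andP[-> /= h1]; apply: leq_trans h1 (containedP _ _ t0 _).
have disj C x : C \in P -> x \in C -> x \in B -> False.
  move=> CP xC xB; have : x \in skew la mu' by apply/(tileP tP); exists C.
  by rewrite sD in_fsetD xB.
have nh := rib_h r; have hh : h - n < h <= h by lia.
exists (B |` P)%fset; last first.
  move=> C; rewrite in_fset1U => /orP[/eqP->|/hP[h' [R [b' r']]]].
    by exists h, (cnt mu).
  by exists h', R; split=> //; apply: leq_trans bh (leq_trans (leqnSn _) b').
split=> //; first split.
- by move=> C; rewrite in_fset1U => /orP[/eqP->|/t1//]; exact: (mv_ribbon m).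
- move=> C C'; rewrite !in_fset1U => /orP[/eqP->|CP] /orP[/eqP->|CP'] ne.
  + by rewrite eqxx in ne.
  + by apply/fdisjointP => x xB; apply/negP => xC; exact: (disj C' x).
  + by apply/fdisjointP => x xC; apply/negP => xB; exact: (disj C x).
  + exact: t2.
- apply/fsetP => x; apply/bigfcupP/idP.
    case=> C; rewrite andbT in_fset1U => /orP[/eqP->|CP] xC; first exact: sub.
    have : x \in skew la mu' by apply/(tileP tP); exists C.
    by rewrite sD in_fsetD => /andP[].
  move=> xD; case xB : (x \in B); first by exists B; rewrite ?in_fset1U ?eqxx.
  have /(tileP tP)[C CP xC] : x \in skew la mu' by rewrite sD in_fsetD xB.
  by exists C; rewrite ?in_fset1U ?CP ?orbT.
- have [mu'h mu'N] := rib_R r hh.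
  move=> C; rewrite in_fset1U => /orP[/eqP->|CP].
    exists (cell h (cnt mu h)); first exact: (topright_rib r).
    case: (posnP (cnt mu h)) => [->|c0]; [by left | right].
    have -> : ((cell h (cnt mu h)).1.-1, (cell h (cnt mu h)).2) = cell h.+1 (cnt mu h).-1.
      by rewrite /cell_at /=; congr (_, _); lia.
    rewrite (@in_skew_cnt N) /=; last by lia.
    rewrite ct_cell; [|lia..].
    (* The count of [mu'] drops by at most one at [h], so [mu] has no bead there and the square
       above the head belongs to [mu]. *)
    case: m => _ s1 s2 e; have := cntS_ge N mu' h; rewrite !e.
    by rewrite (_ : h - n < h.+1 <= h = false) ?hh; lia.
  have [c top tn] := t4 C CP; exists c => //.
  case: tn => [|tn]; [by left | case: (posnP c.1) => [|c0]; [by left|right]].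
  apply/negP => xD; have [h' [R [hh' rC]]] := hP C CP.
  have cE := rib_topright rC top.
  have hC : h' - n < h' <= h' by have := rib_h rC; lia.
  have cc : ct c = h' by rewrite cE (rib_cell_ct rC).
  have cN : c.1 < N by rewrite cE /=; case: (rib_R rC hC).
  (* Only the new ribbon could cover the square above a later head [h'], but that square has content
     [h' + 1], larger than [h]. *)
  have xB : (c.1.-1, c.2) \in B.
    by move: tn; rewrite sD in_fsetD xD andbT negbK.
  have [_ + _] := rib_B r xB.
  by move: cc; rewrite /content /=; lia.
Qed.

End Strips.

(** * Cores *)

Lemma card_diagram (la : partition) : #|` diagram la| = sumn la.
Proof.
rewrite /diagram card_fseq undup_id.
  rewrite size_allpairs_dep; congr sumn; rewrite -[RHS](mkseq_nth 0) /mkseq.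
  by apply: eq_map => i; rewrite size_iota.
apply: allpairs_uniq_dep; rewrite ?iota_uniq //; first by move=> *; exact: iota_uniq.
by move=> [i j] [i' j'] _ _ /= [-> ->].
Qed.

Lemma card_skew (la mu : partition) : contained mu la ->
  #|` skew la mu| = sumn la - sumn mu.
Proof. by move=> c; rewrite /skew cardfsDS // !card_diagram. Qed.

Lemma contained_sumn (la mu : partition) : contained mu la -> sumn mu <= sumn la.
Proof. by move=> c; rewrite -!card_diagram fsubset_leq_card. Qed.

Section Cores.
Variables (N n : nat).
Local Notation cnt := (bead_count N).
Local Notation bd := (bead N).
Local Notation mv := (adds_ribbon N n).
Local Notation bstrip := (bead_strip N n).

Lemma mv_sumn h mu la : mv h mu la -> sumn la = sumn mu + n.
Proof.
move=> m; have r := mv_rib m; have c := mv_contained m.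
have := rib_card r; rewrite card_skew //; have := contained_sumn c.
by case: m => /andP[n0 _] _ _ _; lia.
Qed.

Lemma mv_bd h mu la t : mv h mu la -> bd la t + (t == h - n) = bd mu t + (t == h).
Proof.
case=> nh _ _ e; have := cntS_ge N mu t; have := cntS_ge N la t.
have := cnt_decr N mu (leqnSn t); have := cnt_decr N la (leqnSn t).
rewrite /bead !e.
case: (eqVneq t h) => [->|]; case: (eqVneq _ (h - n)); lia.
Qed.

Lemma mv_removes h mu la : mv h mu la -> removes_ribbon n la mu.
Proof. by move=> m; split; [exact: mv_contained m | exact: mv_ribbon m]. Qed.

(** On each diagonal the removed squares fill the rows between the two counts, and a ribbon has
    exactly one square on each of its diagonals. *)
Lemma removes_mv (mu la : partition) : 0 < n -> size la <= N -> removes_ribbon n la mu ->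
  exists h, mv h mu la.
Proof.
move=> n0 sla [c rb]; have smu := leq_trans (contained_size c) sla.
have [|h [R r]] := ribbon_rib n0 rb (N := N).
  by move=> x; rewrite in_skew => /andP[_ /(row_ltN sla)].
exists h; split=> //; first exact: (rib_h r).
move=> t; have ct_le := (contained_cntP _ smu c) t.
have cl := cnt_le N la t; have cg := cnt_ge N mu t.
have inB i : cnt mu t <= i < cnt la t -> h - n < t <= h /\ i = R t.
  move=> hi; have iN : i < N by lia.
  have e : content N (cell_at N t i) = t by rewrite ct_cell; lia.
  have xB : cell_at N t i \in skew la mu by rewrite (@in_skew_cnt N) // e.
  by have [_] := rib_B r xB; rewrite e /=.
case ht : (h - n < t <= h); last first.
  rewrite addn0; apply/eqP; rewrite eqn_leq ct_le andbT leqNgt; apply/negP => h1.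
  by have [] := inB (cnt mu t); rewrite ?leqnn ?h1 // ht.
have : cell_at N t (R t) \in skew la mu by apply: (rib_in r).
have [a b] := rib_R r ht.
rewrite (@in_skew_cnt N) // ct_cell ?(ltnW a) // => h1.
case: (ltnP (cnt mu t).+1 (cnt la t)) => h2; last by lia.
have [|_ e1] := inB (cnt mu t); first lia.
by have [|_ e2] := inB (cnt mu t).+1; lia.
Qed.

Lemma ex_mv_remove h (la : partition) : 0 < n <= h -> size la <= N ->
  bd la (h - n) = 0 -> bd la h = 1 -> exists mu, mv h mu la.
Proof.
move=> nh s b0 b1.
have [T hT] : exists T, cnt la T = 0.
  exists (row la 0 + N); apply/eqP; rewrite -leqn0 leqNgt; apply/negP => h1.
  have N0 : 0 < N by apply: leq_trans h1 (cnt_le _ _ _).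
  by move: h1; rewrite ltn_cnt //; lia.
have pos c : c <= h -> 0 < cnt la c.
  by move=> ch; apply: leq_trans (cnt_decr N la ch); rewrite cntE b1.
have [| | |mu smu e] := @ex_partition N (fun c => cnt la c - (h - n < c <= h)) T.
- move=> c; have := cntE N la c; have := bd_le1 N la c; have := pos c; have := pos c.+1.
  case: (eqVneq c (h - n)) => [->|c1]; first by rewrite b0; lia.
  case: (eqVneq c h) => [->|c2]; first by rewrite b1; lia.
  lia.
- by rewrite cnt0 subn0.
- by rewrite hT.
exists mu; split=> // c; rewrite e; have := pos c.
by case hc : (h - n < c <= h) => /= p; lia.
Qed.

Definition irreducible_ribbon (ka : partition) := forall mu, ~ removes_ribbon n ka mu.

Lemma irreducible_bd ka t : 0 < n -> size (parts ka) <= N -> irreducible_ribbon ka ->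
  bd ka (t + n) <= bd ka t.
Proof.
move=> n0 s irr; rewrite leqNgt; apply/negP => h.
have := bd_le1 N ka (t + n) => h1.
have [| | | |mu m] := @ex_mv_remove (t + n) ka; rewrite ?addnK ?n0 ?leq_addl //; try lia.
exact: irr (mv_removes m).
Qed.

(** The last move of a nonempty strip would be a removable ribbon. *)
Lemma bstrip_irreducible b al de k s : bstrip b al de k s -> irreducible_ribbon de ->
  [/\ al = de, k = 0 & s = 0].
Proof.
elim=> {b al de k s} [//|b h mu mu' la k s _ m _ IH] irr.
have [e _ _] := IH irr; rewrite e in m.
by case: (irr mu); exact: (mv_removes m).
Qed.

(** The beads on runner [r] of the [n]-runner abacus. [T] places per runner suffice if no bead is at
    [T] or beyond. *)
Definition residue_count r T (la : partition) := \sum_(i < T) bd la (r + i * n).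

Definition same_residues T (mu la : partition) :=
  forall r, r < n -> residue_count r T mu = residue_count r T la.

Lemma sum_residue r T h : 0 < n -> r < n -> h < T ->
  \sum_(i < T) (r + i * n == h) = (r == h %% n).
Proof.
move=> n0 rn hT; have hnT : h %/ n < T by apply: leq_ltn_trans (leq_div _ _) hT.
rewrite (bigD1 (Ordinal hnT)) //= big1 ?addn0 => [|i].
  by rewrite {2}(divn_eq h n) [_ + _ %% _]addnC eqn_add2r.
rewrite -val_eqE /= => ne; apply/eqP; rewrite eqb0; apply: contra ne => /eqP <-.
by rewrite addnC divnMDl // divn_small // addn0.
Qed.

Lemma mv_residues T h mu la : mv h mu la -> cnt la T = 0 -> same_residues T mu la.
Proof.
move=> m lT r rn; have [/andP[n0 nh] _ _ e] := m.
have hT : h < T.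
  rewrite ltnNge; apply/negP => Th; have := cnt_decr N la Th.
  by rewrite lT e; lia.
apply/eqP; rewrite -(eqn_add2r (\sum_(i < T) (r + i * n == h))) -big_split /=.
rewrite -(eq_bigr _ (fun (i : 'I_T) _ => mv_bd (r + i * n) m)) big_split /=.
rewrite eqn_add2l !sum_residue //; last by lia.
by rewrite -{2}(subnK nh) modnDr.
Qed.

Lemma bstrip_contained b mu la k s : bstrip b mu la k s -> contained mu la.
Proof.
elim=> {b mu la k s} [b mu|b h mu mu' la k s _ m _ c]; first exact/containedP.
by apply/containedP => i; apply: leq_trans (containedP _ _ (mv_contained m) i) (containedP _ _ c i).
Qed.

Lemma bstrip_sumn b mu la k s : bstrip b mu la k s -> sumn la = sumn mu + n * k.
Proof.
elim=> {b mu la k s} [b mu|b h mu mu' la k s _ m _ ->]; first by rewrite muln0 addn0.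
by rewrite (mv_sumn m) mulnS addnA.
Qed.

Lemma contained_cnt0 (mu la : partition) T : contained mu la -> size la <= N ->
  cnt la T = 0 -> cnt mu T = 0.
Proof.
move=> c sl lT; have := (contained_cntP _ (leq_trans (contained_size c) sl) c) T.
by rewrite lT leqn0 => /eqP.
Qed.

Lemma bstrip_residues T b mu la k s : bstrip b mu la k s -> size la <= N -> cnt la T = 0 ->
  same_residues T mu la.
Proof.
elim=> {b mu la k s} [//|b h mu mu' la k s _ m bs IH] sl lT r rn.
rewrite -IH //; apply: (mv_residues m) => //.
exact: contained_cnt0 (bstrip_contained bs) sl lT.
Qed.

Lemma reach_residues T (la ka : partition) : 0 < n ->
  clos_refl_trans_1n _ (removes_ribbon n) la ka ->
  size la <= N -> cnt la T = 0 ->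
  [/\ size ka <= N, cnt ka T = 0 & same_residues T ka la].
Proof.
move=> n0; elim=> {la ka} [la|la mu ka rm _ IH] sl lT; first by split.
have [h m] := removes_mv n0 sl rm; have [c _] := rm.
have [||s1 c1 h1] := IH; first exact: leq_trans (contained_size c) sl.
  exact: contained_cnt0 c sl lT.
by split=> // r rn; rewrite h1 // (mv_residues m).
Qed.

(** Ones come before zeros, so the sum determines the sequence. This is applied to a runner of a
    core, whose beads are pushed to the left. *)
Lemma antitone_bits (f : nat -> nat) M i : (forall i, f i <= 1) -> (forall i, f i.+1 <= f i) ->
  i < M -> f i = (i < \sum_(j < M) f j).
Proof.
move=> f1 fa iM; have fd j k : j <= k -> f k <= f j.
  by move=> /subnK <-; elim: (k - j) => // d; rewrite addSn; apply: leq_trans.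
have S1 : f i * i.+1 <= \sum_(j < M) f j.
  rewrite -(subnKC iM) big_split_ord /=; apply: leq_trans (leq_addr _ _).
  apply: (@leq_trans (\sum_(j < i.+1) f i)); first by rewrite sum_nat_const card_ord mulnC.
  by apply: leq_sum => j _; apply: fd; rewrite -ltnS.
have S2 : f i = 0 -> \sum_(j < M) f j <= i.
  move=> fi; rewrite -(subnKC (ltnW iM)) big_split_ord /= [X in _ + X]big1 ?addn0.
    apply: (@leq_trans (\sum_(j < i) 1)); first exact: leq_sum.
    by rewrite sum1_card card_ord.
  by move=> j _; apply/eqP; rewrite -leqn0 -fi fd // leq_addr.
by move: S1 S2; have := f1 i; case: (f i) => [|[|]] // _; [move=> _ /(_ erefl) | rewrite mul1n => h _]; case: ltnP => //; lia.
Qed.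

Lemma residues_inj T (de ka : partition) : 0 < n ->
  size de <= N -> size ka <= N -> cnt de T = 0 -> cnt ka T = 0 ->
  irreducible_ribbon de -> irreducible_ribbon ka -> same_residues T de ka -> de = ka.
Proof.
move=> n0 sd sk dT kT id ik rs; apply: (eq_bd sd sk dT kT) => t tT.
have rn : t %% n < n by rewrite ltn_mod.
have iT : t %/ n < T by apply: leq_ltn_trans (leq_div _ _) tT.
have bits la : size (parts la) <= N -> irreducible_ribbon la ->
    bd la t = (t %/ n < residue_count (t %% n) T la).
  move=> sl il; rewrite {1}(divn_eq t n) addnC.
  apply: (@antitone_bits (fun i => bd la (t %% n + i * n))) => // i; first exact: bd_le1.
  by rewrite mulSn [n + _]addnC addnA irreducible_bd.
by rewrite !bits // rs.
Qed.

End Cores.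

Section Ncore.
Variable n : nat.
Hypothesis n_gt0 : 0 < n.

Lemma removes_sumn (la mu : partition) : removes_ribbon n la mu -> sumn mu < sumn la.
Proof.
by move=> /(removes_mv n_gt0 (leqnn (size la)))[h /mv_sumn ->]; rewrite -addn1 leq_add2l.
Qed.

(** Each removal lowers the size, so the set in the definition of [ncore] is nonempty and [xget]
    picks an element of it. *)
Lemma ncoreP la : clos_refl_trans_1n _ (removes_ribbon n) la (ncore n la) /\
  irreducible_ribbon n (ncore n la).
Proof.
rewrite /ncore; apply: (@xgetPex _ la
  [set ka | clos_refl_trans_1n _ (removes_ribbon n) la ka /\
            forall mu, ~ removes_ribbon n ka mu]%classic).
have [m] := ubnP (sumn la); elim: m la => // m IH la lm.
have [[mu rm]|no] := pselect (exists mu, removes_ribbon n la mu).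
  have [|ka [r irr]] := IH mu; first by have := removes_sumn rm; lia.
  by exists ka; split=> //; exact: rt1n_trans rm r.
by exists la; split; [exact: rt1n_refl | move=> mu rm; apply: no; exists mu].
Qed.

Lemma ncore_irreducible de : is_ncore n de -> irreducible_ribbon n de.
Proof. by move=> <-; case: (ncoreP de). Qed.

(** Ribbon removals keep a bead on its runner, and the runner counts determine a core. *)
Lemma ncore_residues N T (de la : partition) : irreducible_ribbon n de ->
  size de <= N -> size la <= N -> bead_count N de T = 0 -> bead_count N la T = 0 ->
  same_residues N n T de la -> ncore n la = de.
Proof.
move=> id sd sl dT lT rs; have [r irr] := ncoreP la.
have [s1 c1 h1] := reach_residues n_gt0 r sl lT.
apply/esym/(residues_inj n_gt0 sd s1 dT c1 id irr) => x xn.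
by rewrite rs // h1.
Qed.

End Ncore.

Local Open Scope ring_scope.

(** * Transfer matrices and the commutation relation *)

Fixpoint words (L : nat) : seq (seq bool) :=
  if L is L'.+1 then map (cons false) (words L') ++ map (cons true) (words L')
  else [:: [::]].

Local Notation ones := (count id).

Section Transfer.
Variables (A : comNzRingType) (q : A).

(* The weight of the strip between the inner word [al] and the outer word [la],
   which is read [n = size s] positions late. The state [s] lists which of the
   last [n] positions are occupied; the bead leaving it either stays in [la], or
   jumps over the other beads of the state to the position being read. *)
Fixpoint word_weight (x : A) (al la s : seq bool) : A :=
  match al, la, s with
  | a :: al', l :: la', s0 :: w =>
      if (l && ~~ s0) || (a && (s0 && ~~ l)) then 0 else
      (x * q ^+ ones w) ^+ (s0 && ~~ l) *
      word_weight x al' la' (rcons w (a || (s0 && ~~ l)))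
  | [::], [::], _ => (~~ has id s)%:R
  | _, _, _ => 0
  end.

Variables (x y : A).

(* For the pairs [E] of letters of two words: the sum over the common outer word
   of the product of both strip weights, the words being continued by empty
   positions, whose contribution is [term]. *)
Fixpoint outer_sum (term : seq bool -> seq bool -> A) (E : seq (bool * bool))
    (w w' : seq bool) : A :=
  match E, w, w' with
  | [::], _, _ => term w w'
  | (a, b) :: E', s :: v, s' :: v' =>
      (if s && s' then outer_sum term E' (rcons v a) (rcons v' b) else 0) +
      (if (s && a) || (s' && b) then 0 else
       (x * q ^+ ones v) ^+ s * (y * q ^+ ones v') ^+ s' *
       outer_sum term E' (rcons v (a || s)) (rcons v' (b || s')))
  | _, _, _ => 0
  end.

(* The sum over the common inner word, with the roles of [x] and [y] exchanged. *)
Fixpoint inner_sum (E : seq (bool * bool)) (w w' : seq bool) : A :=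
  match E, w, w' with
  | [::], _, _ => (~~ has id w && ~~ has id w')%:R
  | (a, b) :: E', t :: v, t' :: v' =>
      if (a && ~~ t) || (b && ~~ t') then 0 else
      (y * q ^+ ones v) ^+ (t && ~~ a) * (x * q ^+ ones v') ^+ (t' && ~~ b) *
      (inner_sum E' (rcons v (t && ~~ a)) (rcons v' (t' && ~~ b)) +
       if (t && ~~ a) || (t' && ~~ b) then 0
       else inner_sum E' (rcons v true) (rcons v' true))
  | _, _, _ => 0
  end.

(* [P U] is the contribution of the infinite vacuum to the right when both
   states are equal with [U] beads: the pair of beads leaving the state vanishes,
   or both jump over the [U] others. *)
Variable P : nat -> A.
Hypothesis HP : forall U, P U.+1 = P U + x * y * q ^+ (2 * U) * P U.+1.

Definition stationary (w w' : seq bool) : A := if w == w' then P (ones w) else 0.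
Notation fP := (outer_sum stationary).

Lemma ones_rcons u a : ones (rcons u a) = (ones u + a)%N.
Proof. by rewrite -cats1 count_cat /= addn0. Qed.
Lemma ones_mid u a v : ones (u ++ a :: v) = (ones u + a + ones v)%N.
Proof. by rewrite count_cat /= addnA. Qed.

Let ones_E := (ones_rcons, ones_mid, rcons_cat, rcons_cons).

Lemma eq_rcons (u v : seq bool) a b : (rcons u a == rcons v b) = (u == v) && (a == b).
Proof. by rewrite eqseq_rcons. Qed.

(* The next lemmas express the value at words ending with the letters (c, d) by
   the one where these beads are moved [n] positions back, i.e., to the place of
   [s] and [s'] in the states. The weights of the jumps across [V] only see [s]
   and [s'] through their exponents. *)
Lemma outer_sum_neq V c wb wb' u u' s s' : size wb = size V -> size wb' = size V ->
  s != s' -> fP (rcons V (c, c)) (wb ++ s :: u) (wb' ++ s' :: u') = 0.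
Proof.
move=> + + ss; elim: V wb wb' u u' => [|[a b] V IH] [|s1 wb] [|s1' wb'] //= u u'.
  by move=> _ _; case: s s' c ss => [] [] [] //= _;
    rewrite ?(add0r, addr0) // /stationary !eq_rcons /= andbF ?mulr0.
move=> [e] [e']; rewrite !ones_E !IH //; case: (s1 && s1'); case: ifP => _;
  by rewrite ?mulr0 addr0.
Qed.

(** The last letters of the two states can only agree if [s'] jumps onto its empty letter while
    there is no bead at [s]. *)
Lemma outer_sum_10_neq V wb wb' u u' s s' : size wb = size V -> size wb' = size V ->
  s || ~~ s' -> fP (rcons V (true, false)) (wb ++ s :: u) (wb' ++ s' :: u') = 0.
Proof.
move=> + + ss; elim: V wb wb' u u' => [|[a b] V IH] [|s1 wb] [|s1' wb'] //= u u'.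
  move=> _ _; case: s s' ss => [] [] //= _;
    by rewrite ?(add0r, addr0) // /stationary !eq_rcons /= andbF ?mulr0.
move=> [e] [e']; rewrite !ones_E !IH //; case: (s1 && s1'); case: ifP => _;
  by rewrite ?mulr0 addr0.
Qed.

Lemma outer_sum_01_neq V wb wb' u u' s s' : size wb = size V -> size wb' = size V ->
  ~~ s || s' -> fP (rcons V (false, true)) (wb ++ s :: u) (wb' ++ s' :: u') = 0.
Proof.
move=> + + ss; elim: V wb wb' u u' => [|[a b] V IH] [|s1 wb] [|s1' wb'] //= u u'.
  move=> _ _; case: s s' ss => [] [] //= _;
    by rewrite ?(add0r, addr0) // /stationary !eq_rcons /= andbF ?mulr0.
move=> [e] [e']; rewrite !ones_E !IH //; case: (s1 && s1'); case: ifP => _;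
  by rewrite ?mulr0 addr0.
Qed.

Notation ones1 V := (ones (unzip1 V)).
Notation ones2 V := (ones (unzip2 V)).

Lemma outer_sum_00t_base u u' :
  fP [:: (false, false)] (true :: u) (true :: u') = if u == u' then P (ones u).+1 else 0.
Proof.
rewrite /= /stationary !eq_rcons !andbT !ones_E /= addn0 addn1.
case: eqP => [->|_]; last by rewrite mulr0 addr0.
rewrite [in RHS]HP expr1; congr (_ + _); rewrite mul2n -addnn exprD; ring.
Qed.

Lemma outer_sum_11f_base u u' :
  fP [:: (true, true)] (false :: u) (false :: u') = if u == u' then P (ones u).+1 else 0.
Proof.
rewrite /= /stationary !eq_rcons !andbT !ones_E /= addn1 !expr0.
by case: eqP => [->|_]; ring.
Qed.

Lemma outer_sum_00f_base u u' :
  fP [:: (false, false)] (false :: u) (false :: u') = if u == u' then P (ones u) else 0.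
Proof.
rewrite /= /stationary !eq_rcons !andbT !ones_E /= addn0 !expr0.
by case: eqP => [->|_]; ring.
Qed.

(** A jump of the first state across an empty slot [s] has one [q] less than across an occupied one.
    In the induction this is made up by the jumped bead, which joins [u] in the exponent of the
    prefactor. *)
Lemma outer_sum_10 V wb wb' u u' : size wb = size V -> size wb' = size V ->
  fP (rcons V (true, false)) (wb ++ false :: u) (wb' ++ true :: u') =
  y * q ^+ (ones1 V + ones u) *
  fP (rcons V (false, false)) (wb ++ true :: u) (wb' ++ true :: u').
Proof.
elim: V wb wb' u u' => [|[a b] V IH] [|s1 wb] [|s1' wb'] //= u u'.
  move=> _ _; have := outer_sum_00t_base u u'; rewrite [fP _ _ _]/= => ->.
  rewrite /= /stationary !eq_rcons !andbT !ones_E /= addn1 !expr0 expr1.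
  by case: eqP => [->|_]; ring.
move=> [e] [e']; rewrite !ones_E !IH //.
case: a b s1 s1' => [] [] [] [] /=;
 rewrite ?add0r ?addr0 ?mulr0 ?ones_E /= ?expr0 ?expr1 ?mul1r ?mulr1 ?addn0 ?addn1 ?add1n ?add0n ?exprD ?exprS ?exprD; ring.
Qed.

Lemma outer_sum_01 V wb wb' u u' : size wb = size V -> size wb' = size V ->
  fP (rcons V (false, true)) (wb ++ true :: u) (wb' ++ false :: u') =
  x * q ^+ (ones2 V + ones u') *
  fP (rcons V (false, false)) (wb ++ true :: u) (wb' ++ true :: u').
Proof.
elim: V wb wb' u u' => [|[a b] V IH] [|s1 wb] [|s1' wb'] //= u u'.
  move=> _ _; have := outer_sum_00t_base u u'; rewrite [fP _ _ _]/= => ->.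
  rewrite /= /stationary !eq_rcons !andbT !ones_E /= addn1 !expr0 expr1.
  by case: eqP => [->|_]; ring.
move=> [e] [e']; rewrite !ones_E !IH //.
case: a b s1 s1' => [] [] [] [] /=;
 rewrite ?add0r ?addr0 ?mulr0 ?ones_E /= ?expr0 ?expr1 ?mul1r ?mulr1 ?addn0 ?addn1 ?add1n ?add0n ?exprD ?exprS ?exprD; ring.
Qed.

(** Occupied letters block the jump of both beads; with empty letters, staying and jumping add up to
    the same value by [HP]. *)
Lemma outer_sum_11t V wb wb' u u' : size wb = size V -> size wb' = size V ->
  fP (rcons V (true, true)) (wb ++ true :: u) (wb' ++ true :: u') =
  fP (rcons V (false, false)) (wb ++ true :: u) (wb' ++ true :: u').
Proof.
elim: V wb wb' u u' => [|[a b] V IH] [|s1 wb] [|s1' wb'] //= u u'.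
  move=> _ _; have := outer_sum_00t_base u u'; rewrite [fP _ _ _]/= => ->.
  by rewrite /= /stationary !eq_rcons !andbT !ones_E /= addn1 addr0.
by move=> [e] [e']; rewrite !ones_E !IH.
Qed.

(** At the end of [V] this is [HP] itself: the occupied letters add one bead to both states. *)
Lemma outer_sum_11f V wb wb' u u' : size wb = size V -> size wb' = size V ->
  fP (rcons V (true, true)) (wb ++ false :: u) (wb' ++ false :: u') =
  fP (rcons V (false, false)) (wb ++ false :: u) (wb' ++ false :: u') +
  x * y * q ^+ (ones1 V + ones2 V + ones u + ones u') *
  fP (rcons V (false, false)) (wb ++ true :: u) (wb' ++ true :: u').
Proof.
elim: V wb wb' u u' => [|[a b] V IH] [|s1 wb] [|s1' wb'] //= u u'.
  move=> _ _; have := outer_sum_00t_base u u'; rewrite [fP _ _ _]/= => ->.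
  have := outer_sum_11f_base u u'; rewrite [fP _ _ _]/= => ->.
  have := outer_sum_00f_base u u'; rewrite [fP _ _ _]/= => ->.
  rewrite !add0n.
  case: eqP => [->|_]; last by ring.
  by rewrite [in LHS]HP mul2n -addnn.
move=> [e] [e']; rewrite !ones_E !IH //.
case: a b s1 s1' => [] [] [] [] /=;
 rewrite ?add0r ?addr0 ?mulr0 ?ones_E /= ?expr0 ?expr1 ?mul1r ?mulr1 ?addn0 ?addn1 ?add1n ?add0n ?exprD ?exprS ?exprD; ring.
Qed.

Lemma sum_words_cons L (F : seq bool -> A) :
  \sum_(w <- words L.+1) F w =
  \sum_(w <- words L) (F (false :: w) + F (true :: w)).
Proof. by rewrite big_cat !big_map big_split. Qed.

Lemma sum_words_rcons L (F : seq bool -> A) :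
  \sum_(w <- words L.+1) F w =
  \sum_(w <- words L) (F (rcons w false) + F (rcons w true)).
Proof.
elim: L F => [|L IH] F; first by rewrite !sum_words_cons !big_seq1.
rewrite [LHS]sum_words_cons [RHS]sum_words_cons.
rewrite (IH (fun w => F (false :: w) + F (true :: w))).
by apply: eq_bigr => w _; rewrite !rcons_cons; ring.
Qed.

Lemma size_words L w : w \in words L -> size w = L.
Proof.
elim: L w => [|L IH] w /=; first by rewrite inE => /eqP->.
by rewrite mem_cat => /orP[] /mapP[v /IH <- ->].
Qed.

Lemma mem_words w : w \in words (size w).
Proof.
by elim: w => [//|[] w IH] /=; rewrite mem_cat (map_f (cons _) IH) ?orbT.
Qed.

Lemma uniq_words L : uniq (words L).
Proof.
elim: L => [//|L IH] /=; rewrite cat_uniq !map_inj_uniq ?IH //=; try by move=> ? ? [].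
by rewrite andbT; apply/hasPn => _ /mapP[v _ ->]; apply/mapP => -[].
Qed.

#[local] Arguments words : simpl never.

(** [HP] says precisely that reading a pair of empty letters fixes [stationary]. *)
Lemma outer_sum_rcons00 E w w' : size w = size w' -> (0 < size w)%N ->
  fP (rcons E (false, false)) w w' = fP E w w'.
Proof.
elim: E w w' => [|[a b] E IH] [|s v] [|s' v'] //= [e] _; last first.
  by rewrite !IH // ?size_rcons ?e.
rewrite /stationary !eq_rcons eqseq_cons !andbT !ones_E /=.
case: s s' => [] [] /=; rewrite ?andbF ?mulr0 ?addr0 ?add0r ?expr0 ?expr1 ?mul1r //;
  case: eqP => [->|_]; rewrite ?mulr0 ?addr0 ?addn0 ?addn1 ?add1n ?add0n //.
by rewrite [in RHS]HP mul2n -addnn exprD eqxx /=; ring.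
Qed.

(** The exchange relation for a single pair of letters: an outer step on the left, an inner step on
    the right. It is a finite check over [a], [b], [s], [s'] once every value is expressed by words
    ending with empty letters. *)
Lemma outer_inner_step a b v v' (G : seq bool -> seq bool -> A) s s' wb wb' :
  size v = size v' -> size wb = size v -> size wb' = size v ->
  let V := zip v v' in
  \sum_(c <- [:: false; true]) \sum_(d <- [:: false; true])
    fP ((a, b) :: rcons V (c, d)) (s :: wb) (s' :: wb') * G (rcons v c) (rcons v' d) =
  \sum_(t <- [:: false; true]) \sum_(t' <- [:: false; true])
    fP ((t, t') :: V) (s :: wb) (s' :: wb') *
    (if (a && ~~ t) || (b && ~~ t') then 0 else
      (y * q ^+ ones v) ^+ (t && ~~ a) * (x * q ^+ ones v') ^+ (t' && ~~ b) *
      (G (rcons v (t && ~~ a)) (rcons v' (t' && ~~ b)) +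
       if (t && ~~ a) || (t' && ~~ b) then 0
       else G (rcons v true) (rcons v' true))).
Proof.
move=> e e1 e2 V.
have V1 : ones (unzip1 V) = ones v by rewrite unzip1_zip ?e.
have V2 : ones (unzip2 V) = ones v' by rewrite unzip2_zip ?e.
have sV : size V = size v by rewrite size_zip -e minnn.
have z1 : size wb = size V by rewrite e1.
have z2 : size wb' = size V by rewrite e2.
rewrite !big_cons !big_nil.
(* Padding gives both sides words of the same length. Once the first pair is read, the last slot of
   each state is [n] positions before the last letter, as in the preceding lemmas with [u] empty. *)
have vac t t' : fP ((t, t') :: V) (s :: wb) (s' :: wb') =
    fP ((t, t') :: rcons V (false, false)) (s :: wb) (s' :: wb').
  by rewrite -rcons_cons outer_sum_rcons00 //= e1 e2.
rewrite !vac /= -!(cats1 wb) -!(cats1 wb').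
pose Q c d i j := fP (rcons V (c, d)) (wb ++ [:: i]) (wb' ++ [:: j]).
have Z : (Q true false true true = 0) * (Q true false false false = 0) *
  (Q true false true false = 0) * (Q false true true true = 0) *
  (Q false true false false = 0) * (Q false true false true = 0) *
  (Q true true true false = 0) * (Q true true false true = 0) *
  (Q false false true false = 0) * (Q false false false true = 0).
  by do ![split]; rewrite /Q ?outer_sum_10_neq ?outer_sum_01_neq ?outer_sum_neq.
rewrite {}/Q in Z.
case: a b s s' {vac} => [] [] [] [] /=;
  rewrite ?expr0 ?expr1 ?mul1r ?mulr1 ?add0r ?addr0 ?mul0r ?mulr0 ?addr0 ?add0r;
  rewrite ?Z ?(outer_sum_10 _ _ z1 z2) ?(outer_sum_01 _ _ z1 z2) ?(outer_sum_11t _ _ z1 z2) ?(outer_sum_11f _ _ z1 z2) //=;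
  rewrite ?V1 ?V2 /= ?addn0 ?exprD; ring.
Qed.

(* [outer_sum (zip v v')] is the intertwiner of the two transfer matrices: the
   words [v], [v'] followed by the vacuum have [inner_sum] supported at (v, v'). *)
Lemma outer_inner E w w' n : size w = n -> size w' = n -> (0 < n)%N ->
  fP E w w' = \sum_(v <- words n) \sum_(v' <- words n) fP (zip v v') w w' * inner_sum E v v'.
Proof.
move=> + + n0; elim: E w w' => [|[a b] E IH] w w' sw sw'.
  (* Once no letters are left, the inner sum is supported on states without beads, and their zip is
     a vacuum that [stationary] does not see. *)
  rewrite (bigD1_seq (nseq n false)) ?uniq_words //=; last first.
    by rewrite -{2}(size_nseq n false) mem_words.
  rewrite (bigD1_seq (nseq n false)) ?uniq_words //=; last first.
    by rewrite -{2}(size_nseq n false) mem_words.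
  have zero v : v \in words n -> v != nseq n false -> has id v.
    move=> /size_words <-; apply: contraNT => /hasPn h; apply/eqP.
    by apply/all_pred1P/allP => b /h; case: b.
  have hn : has id (nseq n false) = false by rewrite has_nseq andbF.
  rewrite hn mulr1 [X in _ + X + _]big_seq_cond [X in _ + X + _]big1 ?addr0; last first.
    by move=> v /andP[vn v0]; rewrite zero // mulr0.
  rewrite [X in _ + X]big_seq_cond [X in _ + X]big1 ?addr0; last first.
    move=> v /andP[vn v0]; rewrite big1 // => v' _.
    by rewrite (zero v) //= mulr0.
  have -> : zip (nseq n false) (nseq n false) = nseq n (false, false).
    by elim: (n) => //= k ->.
  have -> k : fP (nseq k (false, false)) w w' = stationary w w'; last by [].
  by elim: k => [//|k IH]; rewrite -addn1 nseqD cats1 outer_sum_rcons00 ?sw ?sw'.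
case: n n0 IH sw sw' => // p _ IH sw sw'.
case: w w' sw sw' => [|s wb] [|s' wb'] // [sw] [sw'].
transitivity (\sum_(v <- words p.+1) \sum_(v' <- words p.+1)
   fP ((a, b) :: zip v v') (s :: wb) (s' :: wb') * inner_sum E v v').
  rewrite /= !IH ?size_rcons ?sw ?sw' //.
  case: (s && s'); case: ifP => _; rewrite ?add0r ?addr0 //.
  - by apply: eq_bigr => v _; apply: eq_bigr => v' _; ring.
  - rewrite mulr_sumr -big_split; apply: eq_bigr => v _ /=.
    rewrite mulr_sumr -big_split; apply: eq_bigr => v' _ /=.
    by rewrite mulrA mulrDl.
  - by rewrite big1 // => v _; rewrite big1 // => v' _; rewrite mul0r.
  - rewrite mulr_sumr; apply: eq_bigr => v _; rewrite mulr_sumr; apply: eq_bigr => v' _.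
    by rewrite add0r mulrA.
rewrite sum_words_rcons [RHS]sum_words_cons big_seq [RHS]big_seq; apply: eq_bigr => v /size_words sv.
rewrite -!big_split [LHS]sum_words_rcons [RHS]sum_words_cons big_seq [RHS]big_seq; apply: eq_bigr => v' /size_words sv'.
have := @outer_inner_step a b v v' (inner_sum E) s s' wb wb'; rewrite sv sv' => /(_ erefl sw sw') /=.
rewrite !big_cons !big_nil /= ?addr0 !zip_rcons ?sv ?sv' // => h.
move: h; rewrite !addrA => h.
by etransitivity; last (etransitivity; [exact: h|]); ring.
Qed.

Definition vacuum (w w' : seq bool) : A := (~~ has id w && ~~ has id w')%:R.

Lemma sum_words_outer al be w w' : size al = size be -> size w = size w' ->
  \sum_(l <- words (size al)) word_weight x al l w * word_weight y be l w' =
  outer_sum vacuum (zip al be) w w'.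
Proof.
elim: al be w w' => [|a al IH] [|b be] w w' // => [_ ew|[e] ew].
  by rewrite big_seq1 /= /vacuum -natrM mulnb.
rewrite sum_words_cons big_split /=.
case: w w' ew => [|s v] [|s' v'] // => [_|[ev]]; first by rewrite !big1 ?addr0 // => l _; rewrite mul0r.
rewrite addrC; congr (_ + _).
  case: s => /=; last by rewrite big1 // => l _; rewrite mul0r.
  case: s' => /=; last by rewrite big1 // => l _; rewrite mulr0.
  rewrite !andbF !orbF -IH ?size_rcons ?ev //.
  by apply: eq_bigr => l _; rewrite !expr0 !mul1r.
rewrite !andbT [s && a]andbC [s' && b]andbC.
case: (a && s) => /=; first by rewrite big1 // => l _; rewrite mul0r.
case: (b && s') => /=; first by rewrite big1 // => l _; rewrite mulr0.
rewrite -IH ?size_rcons ?ev // mulr_sumr.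
by apply: eq_bigr => l _; rewrite mulrACA.
Qed.

Lemma sum_word_weight_inner al be w w' : size al = size be -> size w = size w' ->
  \sum_(m <- words (size al)) word_weight y m al w * word_weight x m be w' = inner_sum (zip al be) w w'.
Proof.
elim: al be w w' => [|a al IH] [|b be] w w' // => [_ ew|[e] ew].
  by rewrite big_seq1 /= -natrM mulnb.
rewrite sum_words_cons big_split /=.
case: w w' ew => [|s v] [|s' v'] // => [_|[ev]]; first by rewrite !big1 ?addr0 // => l _; rewrite mul0r.
case: (a && ~~ s) => /=; first by rewrite !big1 ?addr0 // => l _; rewrite mul0r.
case: (b && ~~ s') => /=; first by rewrite !big1 ?addr0 // => l _; rewrite mulr0.
rewrite mulrDr; congr (_ + _).
  rewrite -IH ?size_rcons ?ev // mulr_sumr.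
  by apply: eq_bigr => l _; rewrite mulrACA.
case: (s && ~~ a) => /=; first by rewrite mulr0 big1 // => l _; rewrite mul0r.
case: (s' && ~~ b) => /=; first by rewrite mulr0 big1 // => l _; rewrite mulr0.
rewrite -IH ?size_rcons ?ev // mulr_sumr.
by apply: eq_bigr => l _; rewrite mulrACA.
Qed.

Lemma rcons_nseq (T : Type) k (c : T) : rcons (nseq k c) c = c :: nseq k c.
Proof. by elim: k => //= k ->. Qed.

Lemma zip_nseq_ones n al be : zip (nseq n true ++ al) (nseq n true ++ be) =
  nseq n (true, true) ++ zip al be.
Proof. by elim: n => //= n ->. Qed.

Lemma outer_sum_ones term k n E : outer_sum term (nseq k (true, true) ++ E) (nseq n.+1 true) (nseq n.+1 true) =
  outer_sum term E (nseq n.+1 true) (nseq n.+1 true).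
Proof. by elim: k => [//|k IH] /=; rewrite !rcons_nseq addr0 IH. Qed.

(** A bead of an outer word must already be in the state when its position is read. *)
Lemma inner_sum_ones k E v v' : (k <= size v)%N -> (k <= size v')%N ->
  ~~ (all id (take k v) && all id (take k v')) ->
  inner_sum (nseq k (true, true) ++ E) v v' = 0.
Proof.
elim: k v v' => [|k IH] [|s v] [|s' v'] //= kv kv' h.
case: ifP => // /norP[/negbNE s1 /negbNE s1']; rewrite s1 s1' /=.
rewrite !IH ?addr0 ?mulr0 // ?size_rcons; try exact: leq_trans (leqnSn _).
  by move: h; rewrite s1 s1' -!cats1 !takel_cat.
by move: h; rewrite s1 s1' -!cats1 !takel_cat.
Qed.

(** The occupied prefix does not affect full outer states, since it blocks all jumps, but it forces
    the inner states to be full. The one remaining term of [outer_inner] has coefficient [P n]. *)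
Lemma outer_inner_ones n al be : (0 < n)%N ->
  fP (zip al be) (nseq n true) (nseq n true) =
  P n * inner_sum (zip (nseq n true ++ al) (nseq n true ++ be)) (nseq n true) (nseq n true).
Proof.
case: n => // n _; rewrite zip_nseq_ones -(outer_sum_ones _ n.+1).
have nw : nseq n.+1 true \in words n.+1 by rewrite -{2}(size_nseq n.+1 true) mem_words.
have non v : v \in words n.+1 -> v != nseq n.+1 true -> all id v = false.
  move=> /size_words <-; apply: contra_neqF => h.
  by apply/all_pred1P/allP => b /(allP h); case: b.
rewrite (@outer_inner _ _ _ n.+1) ?size_nseq //; set G := inner_sum (_ ++ _).
rewrite (bigD1_seq _ nw) ?uniq_words //= [X in _ + X]big_seq_cond.
rewrite [X in _ + X]big1 ?addr0; last first.
  move=> v /andP[vn v1]; rewrite big_seq big1 // => v' v'n.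
  rewrite /G inner_sum_ones ?mulr0 //.
  - by rewrite (size_words vn).
  - by rewrite (size_words v'n).
  - by rewrite take_oversize ?(size_words vn) // non.
rewrite (bigD1_seq _ nw) ?uniq_words //= [X in _ + X]big_seq_cond.
rewrite [X in _ + X]big1 ?addr0; last first.
  move=> v /andP[vn v1].
  rewrite /G inner_sum_ones ?mulr0 ?size_nseq ?(size_words vn) //.
  by rewrite /= size_nseq.
  by rewrite [take _ v]take_oversize ?(size_words vn) // (non v vn v1) andbF.
congr (_ * _).
have := outer_sum_ones stationary n.+1 n [::]; rewrite cats0 /= addr0 => h.
have -> : zip (nseq n true) (nseq n true) = nseq n (true, true).
  by elim: (n) => //= k ->.
by rewrite h /stationary eqxx /= count_nseq mul1n.
Qed.

Lemma word_weight_take_ones z k mu la v : (k <= size v)%N -> ~~ all id (take k v) ->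
  word_weight z mu (nseq k true ++ la) v = 0.
Proof.
elim: k mu v => [|k IH] [|a mu] [|s v] //= kv h.
case: ifP => // /norP[/negbNE s1 _]; rewrite s1 /= IH ?mulr0 //.
  by rewrite size_rcons leqW.
by move: h; rewrite s1 -cats1 takel_cat.
Qed.

(** The beads in the last [size s] positions of the inner word never leave the state, which has to
    end empty. *)
Lemma word_weight_last z al la s : has id (drop (size al) (s ++ al)) -> word_weight z al la s = 0.
Proof.
elim: al la s => [|a al IH] [|l la] [|s w] //; first by rewrite /= cats0 => ->.
move=> h /=; case: ifP => // _; rewrite IH ?mulr0 //.
move: h; rewrite /= -cats1 -catA /= !drop_cat; case: ltnP => hw.
  by rewrite !has_cat => /orP[->//|]; rewrite /= orbA => /orP[->|->]; rewrite !orbT.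
by case: (_ - _)%N => //= /orP[->//|h]; rewrite h orbT.
Qed.

Lemma sum_words_cat m n (F : seq bool -> A) :
  \sum_(w <- words (m + n)) F w =
  \sum_(u <- words m) \sum_(v <- words n) F (u ++ v).
Proof.
elim: m F => [|m IH] F; first by rewrite big_seq1.
rewrite addSn !sum_words_cons (IH (fun w => F (false :: w) + F (true :: w))).
by apply: eq_bigr => w _; rewrite big_split.
Qed.

Lemma sum_words_inner n L al be : (0 < n)%N -> size al = L -> size be = L ->
  let al' := nseq n true ++ al in let be' := nseq n true ++ be in
  \sum_(mu <- words (n + L)) word_weight y (drop n mu ++ nseq n false) al' (take n mu) *
                           word_weight x (drop n mu ++ nseq n false) be' (take n mu) =
  inner_sum (zip al' be') (nseq n true) (nseq n true).
Proof.
move=> n0 sal sbe al' be'.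
have nw b : nseq n b \in words n by rewrite -{2}(size_nseq n b) mem_words.
have nonb b v : v \in words n -> v != nseq n b -> all (pred1 b) v = false.
  by move=> /size_words <-; apply: contra_neqF => /all_pred1P.
rewrite sum_words_cat (bigD1_seq _ (nw true)) ?uniq_words //=.
rewrite [X in _ + X]big_seq_cond [X in _ + X]big1 ?addr0; last first.
  move=> v /andP[vn v1]; rewrite big1 // => nu _.
  rewrite take_size_cat ?(size_words vn) // word_weight_take_ones ?mul0r //.
    by rewrite (size_words vn).
  rewrite take_oversize ?(size_words vn) //.
  by rewrite (@eq_all _ id (pred1 true)) ?(nonb true) // => -[].
rewrite -sum_word_weight_inner ?size_cat ?size_nseq ?sal ?sbe // addnC sum_words_cat.
rewrite big_seq [RHS]big_seq; apply: eq_bigr => nu /size_words snu.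
rewrite (bigD1_seq _ (nw false)) ?uniq_words //=.
rewrite [X in _ = _ + X]big_seq_cond [X in _ = _ + X]big1 ?addr0; last first.
  move=> u /andP[un u1]; rewrite word_weight_last ?mul0r //.
  rewrite catA drop_cat !size_cat size_nseq snu (size_words un) addnC ltnn subnn drop0.
  by apply: contraFT (nonb false u un u1) => /hasPn h; apply/allP => b /h; case: b.
by rewrite take_size_cat ?size_nseq // drop_size_cat ?size_nseq.
Qed.

(* [I k] stands for the series of order at least [k]. *)
Variable I : nat -> A -> Prop.
Hypothesis I0 : forall a, I 0 a.
Hypothesis Iz : forall k, I k 0.
Hypothesis ID : forall k a b, I k a -> I k b -> I k (a + b).
Hypothesis IM : forall k a b, I k b -> I k (a * b).
Hypothesis Ix : forall k a, I k a -> I k.+1 (x * a).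
Hypothesis Iy : forall k a, I k a -> I k.+1 (y * a).

Lemma outer_sum_cat term E1 E2 w w' : size w = size w' ->
  outer_sum term (E1 ++ E2) w w' = outer_sum (outer_sum term E2) E1 w w'.
Proof.
elim: E1 w w' => [//|[a b] E IH] [|s v] [|s' v'] //= [e].
by rewrite !IH // !size_rcons e.
Qed.

Lemma outer_sum_sub t1 t2 E w w' :
  outer_sum (fun u u' => t1 u u' - t2 u u') E w w' = outer_sum t1 E w w' - outer_sum t2 E w w'.
Proof.
elim: E w w' => [//|[a b] E IH] [|s v] [|s' v'] //=; rewrite ?subr0 //.
by rewrite !IH; case: (s && s'); case: ifP => _; ring.
Qed.

Lemma outer_sum_I k n term E w w' : size w = n -> size w' = n ->
  (forall u u', size u = n -> size u' = n -> I k (term u u')) ->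
  I k (outer_sum term E w w').
Proof.
move=> + + h; elim: E w w' => [|[a b] E IH] [|s v] [|s' v'] //= sw sw'; try exact: h.
apply: ID; case: ifP => _ //; first by apply: IH; rewrite size_rcons.
by apply: IM; apply: IH; rewrite size_rcons.
Qed.

(** Either some bead jumps during the round, which gives a factor [x] or [y], or all beads are left
    behind and the states end empty, where [term] vanishes. The parts [u], [u'] were refilled
    earlier in the round without a jump. *)
Lemma outer_sum_round n k term w w' u u' : size w = size w' ->
  size (w ++ u) = n -> size (w' ++ u') = n ->
  (forall v v', size v = n -> size v' = n -> I k (term v v')) ->
  (forall v v', size v = n -> size v' = n -> ~~ has id v -> ~~ has id v' -> term v v' = 0) ->
  ~~ has id u -> ~~ has id u' ->
  I k.+1 (outer_sum term (nseq (size w) (false, false)) (w ++ u) (w' ++ u')).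
Proof.
move=> e sw sw' h1 h2.
elim: w w' u u' e sw sw' => [|s w IH] [|s' w'] //= u u'.
  by move=> _ su su' hu hu'; rewrite h2.
move=> [e] sw sw' hu hu'; rewrite !rcons_cat; apply: ID.
  case: ifP => // _; apply: IH => //; rewrite ?size_cat ?size_rcons ?addnS -?size_cat //.
    by rewrite has_rcons.
  by rewrite has_rcons.
rewrite !andbF /=.
have Ik r r' : size r = (size u).+1 -> size r' = (size u').+1 ->
    I k (outer_sum term (nseq (size w) (false, false)) (w ++ r) (w' ++ r')).
  by move=> er er'; apply: (@outer_sum_I _ n) => //; rewrite size_cat ?er ?er' addnS -size_cat.
case: s s' => [] [] /=; rewrite ?expr1 ?expr0 ?mulr1 ?mul1r -?mulrA.
- by apply: Ix; do 3 apply: IM; apply: Ik; rewrite size_rcons.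
- by apply: Ix; apply: IM; apply: Ik; rewrite size_rcons.
- by apply: Iy; apply: IM; apply: Ik; rewrite size_rcons.
apply: IH => //; rewrite ?size_cat ?size_rcons ?addnS -?size_cat //; by rewrite has_rcons.
Qed.

Lemma outer_sum_empty term k w w' : size w = size w' -> ~~ has id w -> ~~ has id w' ->
  outer_sum term (nseq k (false, false)) w w' =
  if w is [::] then if k is 0 then term w w' else 0 else term w w'.
Proof.
elim: k w w' => [|k IH] [|s w] [|s' w'] //= [e] /norP[s0 hw] /norP[s0' hw'].
rewrite (negbTE s0) (negbTE s0') /= !expr0 !mul1r add0r IH ?size_rcons ?e ?has_rcons //.
have rn v : ~~ has id v -> rcons v false = false :: v.
  by elim: v => //= b v IHv /norP[/negbTE-> /IHv->].
by rewrite !rn.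
Qed.

Lemma outer_sum_rounds n k j term w w' : (0 < n)%N -> size w = n -> size w' = n ->
  (forall v v', size v = n -> size v' = n -> I k (term v v')) ->
  (forall v v', size v = n -> size v' = n -> ~~ has id v -> ~~ has id v' -> term v v' = 0) ->
  I (k + j) (outer_sum term (nseq (n * j) (false, false)) w w').
Proof.
move=> n0; elim: j k term w w' => [|j IH] k term w w' sw sw' h1 h2.
  by rewrite muln0 addn0; exact: h1.
rewrite mulnS [(n + _)%N]addnC nseqD outer_sum_cat ?sw ?sw' // addnS -addSn; apply: IH => // v v' sv sv'.
  have := @outer_sum_round n k term v v' [::] [::].
  by rewrite !cats0 sv sv'; apply.
move=> hv hv'; rewrite outer_sum_empty ?sv ?sv' // h2 //.
by case: v sv {hv} n0 => // <-.
Qed.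

Hypothesis P0 : P 0 = 1.

(* The vacuum tail of length [n * j] only matters through configurations that
   survive [j] rounds, and each round costs a factor [x] or [y]. *)
Lemma words_comm n L L1 j al be : (0 < n)%N -> size al = L -> size be = L ->
  (L + n = L1 + n * j)%N ->
  drop L1 (al ++ nseq n false) = nseq (n * j) false ->
  drop L1 (be ++ nseq n false) = nseq (n * j) false ->
  let al' := nseq n true ++ al in let be' := nseq n true ++ be in
  I j (\sum_(l <- words (n + L)) word_weight x (al ++ nseq n false) l (nseq n true) *
                               word_weight y (be ++ nseq n false) l (nseq n true) -
       P n * \sum_(mu <- words (n + L))
                  word_weight y (drop n mu ++ nseq n false) al' (take n mu) *
                  word_weight x (drop n mu ++ nseq n false) be' (take n mu)).
Proof.
move=> n0 sal sbe eL dal dbe al' be'; rewrite sum_words_inner // -outer_inner_ones //.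
have sa : size (al ++ nseq n false) = (n + L)%N by rewrite size_cat size_nseq sal addnC.
have sb : size (be ++ nseq n false) = (n + L)%N by rewrite size_cat size_nseq sbe addnC.
rewrite -sa sum_words_outer ?sa ?sb //.
have -> : fP (zip al be) (nseq n true) (nseq n true) =
    fP (zip (al ++ nseq n false) (be ++ nseq n false)) (nseq n true) (nseq n true).
  rewrite zip_cat ?sal ?sbe //.
  have -> k : zip (nseq k false) (nseq k false) = nseq k (false, false).
    by elim: k => //= k ->.
  have h k : fP (zip al be ++ nseq k (false, false)) (nseq n true) (nseq n true) =
     fP (zip al be) (nseq n true) (nseq n true); last by rewrite h.
  elim: k => [|k IH]; first by rewrite cats0.
  by rewrite -addn1 nseqD catA cats1 outer_sum_rcons00 ?size_nseq.
rewrite -[al ++ _](cat_take_drop L1) -[be ++ _](cat_take_drop L1) dal dbe.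
rewrite zip_cat; last by rewrite !size_take sa sb.
have -> k : zip (nseq k false) (nseq k false) = nseq k (false, false).
  by elim: k => //= k ->.
rewrite -outer_sum_sub outer_sum_cat ?size_nseq //.
apply: (@outer_sum_I _ n); rewrite ?size_nseq // => u u' su su'.
(* The difference of [vacuum] and [stationary] vanishes on states without beads because
   [P 0 = 1]. *)
apply: (@outer_sum_rounds n 0 j) => // v v' sv sv' hv hv'.
have z w : ~~ has id w -> w = nseq (size w) false.
  by elim: w => //= b w IHw /norP[/negbTE-> /IHw<-].
rewrite /stationary /vacuum hv hv' (z v hv) (z v' hv') sv sv' eqxx count_nseq mul0n P0 subrr //.
Qed.
End Transfer.

Local Close Scope ring_scope.

(** * Bead words of partitions and the weights of strips *)

Section BeadWords.
Variables (N n : nat).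
Local Notation cnt := (bead_count N).
Local Notation bd := (bead N).
Local Notation mv := (adds_ribbon N n).
Local Notation bstrip := (bead_strip N n).

Definition wseq la a L := [seq bd la t == 1 | t <- iota a L].

Lemma wseqS la a L : wseq la a L.+1 = (bd la a == 1) :: wseq la a.+1 L.
Proof. by []. Qed.

Lemma wseq_rcons la a L : wseq la a L.+1 = rcons (wseq la a L) (bd la (a + L) == 1).
Proof. by rewrite /wseq -(addn1 L) iotaD map_cat cats1. Qed.

Lemma size_wseq la a L : size (wseq la a L) = L.
Proof. by rewrite size_map size_iota. Qed.

Lemma wseqD la a L M : wseq la a (L + M) = wseq la a L ++ wseq la (a + L) M.
Proof. by rewrite /wseq iotaD map_cat. Qed.

Lemma eq_wseq la mu a L : (forall t, a <= t < a + L -> bd la t = bd mu t) ->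
  wseq la a L = wseq mu a L.
Proof. by move=> h; apply/eq_in_map => t; rewrite mem_iota => /h ->. Qed.

Lemma ones_wseq la a L : ones (wseq la a L) = cnt la a - cnt la (a + L).
Proof.
elim: L a => [|L IH] a; first by rewrite addn0 subnn.
rewrite /= IH -addSnnS; have := cntE N la a; have := bd_le1 N la a.
have : cnt la (a.+1 + L) <= cnt la a.+1 by apply: cnt_decr; lia.
by case: eqP => /=; lia.
Qed.

Lemma bd0 la T t : cnt la T = 0 -> T <= t -> bd la t = 0.
Proof. by move=> e /(cnt_decr N la); rewrite /bead; lia. Qed.

Lemma wseq0 la a L T : cnt la T = 0 -> T <= a -> wseq la a L = nseq L false.
Proof.
by move=> e Ta; elim: L a Ta => // L IH a Ta; rewrite wseqS /= (bd0 e Ta) IH // ltnW.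
Qed.

Lemma bstrip_weaken b b' mu la k s : b' <= b -> bstrip b mu la k s -> bstrip b' mu la k s.
Proof.
move=> bb H; case: b mu la k s / H bb => [b mu|b h mu mu' la k s bh m H] bb.
  exact: bead_strip0.
by apply: bead_stripS m H; exact: leq_trans bb bh.
Qed.

Lemma bstrip_low b mu la k s t : bstrip b mu la k s -> t + n < b -> bd la t = bd mu t.
Proof.
elim=> {b mu la k s} // b h mu mu' la k s bh m _ IH tb.
rewrite IH; last by lia.
have := mv_bd t m; case: m => /andP[n0 nh] _ _ _.
by case: eqP; case: eqP; lia.
Qed.

Section Weights.
Local Open Scope ring_scope.
Variables (A : comNzRingType) (q x : A).
Local Notation W := (word_weight q x).

(** The bead at [a] jumps exactly when the next head is [a + n]. Then [mu] is replaced by the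
    partition after this move, so that the state is always a window of the current partition. *)
Lemma word_weight_bstrip L a mu la k s : (0 < n)%N -> bstrip (a + n) mu la k s ->
  cnt la (a + L) = 0%N ->
  W (wseq mu (a + n) L) (wseq la a L) (wseq mu a n) = x ^+ k * q ^+ s.
Proof.
move=> n0; elim: L a mu k s => [|L IH] a mu k s H lT.
  rewrite addn0 in lT; have [-> -> ->] : [/\ k = 0%N, s = 0%N & mu = la].
    move E : (a + n)%N H => b H.
    case: b mu la k s / H E lT => // b h mu mu' {}la k s bh m H E lT; exfalso.
    case: m => nh smu smu' e.
    have c := contained_cntP _ smu' (bstrip_contained H) h; rewrite e in c.
    have ah : (a <= h)%N by lia.
    by have := cnt_decr N la ah; lia.
  by rewrite /= expr0 mul1r (wseq0 n lT (leqnn a)) has_nseq andbF.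
have stepE : wseq mu a n = (bd mu a == 1%N) :: wseq mu a.+1 n.-1 by rewrite -wseqS prednK.
rewrite stepE !wseqS; move E : (a + n)%N H => b H.
have lT' : cnt la (a.+1 + L) = 0%N by rewrite addSnnS.
have same : bstrip (a.+1 + n) mu la k s ->
  W ((bd mu b == 1%N) :: wseq mu b.+1 L) ((bd la a == 1%N) :: wseq la a.+1 L)
    ((bd mu a == 1%N) :: wseq mu a.+1 n.-1) = x ^+ k * q ^+ s.
  move=> H'; rewrite (bstrip_low H' (t := a)) ?addSn ?ltnS // [W _ _ _]/= andbN andbF /=.
  rewrite expr0 mul1r orbF -(IH a.+1 mu) // -E addSn.
  by rewrite -[in RHS](prednK n0) wseq_rcons addSnnS prednK.
case: b mu la k s / H E lT' stepE same lT IH => [b mu|b h mu mu' la k s bh m H] E lT' stepE same lT IH.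
  by apply: same; exact: bead_strip0.
move: bh; rewrite leq_eqVlt => /orP[/eqP bh|bh]; last first.
  by apply: same; rewrite addSn E; apply: bead_stripS m H.
rewrite -bh -E in m H *.
have bm t := mv_bd t m.
have [/andP[_ nh] _ _ _] := m.
have ba := bm a; have bb := bm (a + n)%N; rewrite addnK eqxx in ba bb.
have n1 : (a == a + n)%N = false by apply/eqP; lia.
have n2 : (a + n == a)%N = false by apply/eqP; lia.
rewrite n1 in ba; rewrite n2 eqxx in bb.
have := bd_le1 N mu a; have := bd_le1 N mu' (a + n); have := bd_le1 N mu' a => q1 q2 q3.
have -> : bd mu a = 1%N by lia.
have -> : bd mu (a + n) = 0%N by lia.
have -> : bd la a = 0%N by rewrite (bstrip_low H (t := a)) // ; lia.
rewrite /= expr1 -addSn.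
have other t : t != a -> t != (a + n)%N -> bd mu t = bd mu' t.
  by move=> /negbTE t1 /negbTE t2; have := bm t; rewrite addnK t1 t2 !addn0.
have -> : rcons (wseq mu a.+1 n.-1) true = wseq mu' a.+1 n.
  rewrite -[in RHS](prednK n0) wseq_rcons addSnnS prednK //.
  have -> : bd mu' (a + n) = 1%N by lia.
  by congr rcons; apply: eq_wseq => t ht; apply: other; apply/eqP; lia.
have -> : wseq mu (a.+1 + n) L = wseq mu' (a.+1 + n) L.
  by apply: eq_wseq => t ht; apply: other; apply/eqP; lia.
rewrite (IH a.+1 mu' k s) //.
rewrite ones_wseq addSnnS prednK // addnK exprS exprD; ring.
Qed.

(** A nonzero weight allows two cases at [a]: the letters agree, or a bead jumps to the empty
    position [a + n]. The jumps spell out the strip. *)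
Lemma word_weight_neq0 L a (mu la : partition) : (0 < n)%N -> (size mu <= N)%N -> (size la <= N)%N ->
  (forall t, (t < a)%N -> bd mu t = bd la t) ->
  cnt mu (a + n + L) = 0%N -> cnt la (a + L) = 0%N ->
  W (wseq mu (a + n) L) (wseq la a L) (wseq mu a n) != 0 ->
  exists k s, bstrip (a + n) mu la k s.
Proof.
move=> n0 + sl; elim: L a mu => [|L IH] a mu sm low mT lT.
  rewrite addn0 in lT; rewrite addn0 in mT.
  rewrite /=; case: (boolP (has id _)) => [_|/hasPn h _]; first by rewrite eqxx.
  exists 0%N, 0%N; suff -> : mu = la by exact: bead_strip0.
  have lT' : cnt la (a + n) = 0%N by have := cnt_decr N la (leq_addr n a); lia.
  apply: (eq_bd sm sl mT lT') => t tT; case: (ltnP t a) => [/low //|ta].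
  have := h (bd mu t == 1%N).
  rewrite /wseq (map_f (fun t => bd mu t == 1%N)) ?mem_iota ?ta // => /(_ isT) /=; have := bd_le1 N mu t.
  by have := bd0 lT ta; lia.
have stepE : wseq mu a n = (bd mu a == 1%N) :: wseq mu a.+1 n.-1 by rewrite -wseqS prednK.
rewrite stepE !wseqS [W _ _ _]/=; case: ifP; first by rewrite eqxx.
have mb := bd_le1 N mu a; have lb := bd_le1 N la a.
case: (eqVneq (bd mu a) (bd la a)) => [e _|ne].
  rewrite e andbN orbF expr0 mul1r => Wn0.
  have [||||k [s H]] := IH a.+1 mu sm.
  - by move=> t; rewrite ltnS leq_eqVlt => /orP[/eqP->|/low].
  - by have -> : (a.+1 + n + L = a + n + L.+1)%N by lia.
  - by rewrite addSnnS.
  - move: Wn0; rewrite addSn -[in X in _ -> X](prednK n0) wseq_rcons addSnnS prednK //.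
  exists k, s; apply: bstrip_weaken H; by rewrite addSn.
case: (eqVneq (bd mu a) 1%N) => [m1|m1]; last first.
  by have -> : bd la a = 1%N by lia.
have l0 : bd la a = 0%N by lia.
rewrite l0 /= !andbT orbT => /negbT.
case: (eqVneq (bd mu (a + n)) 1%N) => // mb1 _ Wn0.
have mb0 : bd mu (a + n) = 0%N by have := bd_le1 N mu (a + n); lia.
have [||mu' m] := @ex_mv N n (a + n) mu _ sm _ mb0; first by rewrite n0 leq_addl.
  by rewrite addnK.
have bm t := mv_bd t m.
have [_ _ sm' em] := m.
have other t : t != a -> t != (a + n)%N -> bd mu t = bd mu' t.
  by move=> /negbTE t1 /negbTE t2; have := bm t; rewrite addnK t1 t2 !addn0.
have ba := bm a; have bb := bm (a + n)%N; rewrite addnK eqxx in ba bb.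
have n1 : (a == a + n)%N = false by apply/eqP; lia.
have n2 : (a + n == a)%N = false by apply/eqP; lia.
rewrite n1 in ba; rewrite n2 eqxx in bb.
have [||||k [s H]] := IH a.+1 mu' sm'.
- move=> t; rewrite ltnS leq_eqVlt => /orP[/eqP->|ta]; first by lia.
  by rewrite -low // other //; apply/eqP; lia.
- rewrite em; have -> : (a.+1 + n + L = a + n + L.+1)%N by lia.
  by rewrite mT; lia.
- by rewrite addSnnS.
- move: Wn0; have -> : rcons (wseq mu a.+1 n.-1) true = wseq mu' a.+1 n.
    rewrite -[in RHS](prednK n0) wseq_rcons addSnnS prednK //.
    have -> : bd mu' (a + n) = 1%N by have := bd_le1 N mu' a; lia.
    by congr rcons; apply: eq_wseq => t ht; apply: other; apply/eqP; lia.
  have -> : wseq mu (a + n).+1 L = wseq mu' (a.+1 + n) L.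
    by rewrite addSn; apply: eq_wseq => t ht; apply: other; apply/eqP; lia.
  by apply: contraNneq => ->; rewrite mulr0.
exists k.+1, (cnt mu (a + n - n).+1 - cnt mu (a + n) + s)%N.
by apply: (bead_stripS _ m) => //; rewrite -addSn.
Qed.

(** Beads are moved, never created; this discards the words that do not encode a partition with [N]
    beads. *)
Lemma word_weight_ones (al la s : seq bool) : W al la s != 0 ->
  (ones la = ones s + ones al)%N.
Proof.
elim: al la s => [|a al IH] [|l la] [|s0 w] //=; rewrite ?eqxx //.
  case: (boolP (s0 || has id w)); rewrite ?eqxx // => h _.
  by rewrite addn0; apply/esym/eqP; rewrite -leqn0 leqNgt -[(0 < _)%N]/(0 < count id (s0 :: w))%N -has_count.
case: ifP; rewrite ?eqxx // => h Wn0.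
have := IH la (rcons w (a || s0 && ~~ l)).
rewrite ones_rcons => -> //; first by move: h; case: s0 a l {Wn0} => [] [] [] //=; lia.
by apply: contraNneq Wn0 => ->; rewrite mulr0.
Qed.

End Weights.

Lemma ex_word T (w : seq bool) : size w = T -> ones w = N ->
  exists la : partition, [/\ size la <= N, cnt la T = 0 & wseq la 0 T = w].
Proof.
move=> sw ow; pose k c := ones (drop c w).
have kS c : k c = nth false w c + k c.+1.
  rewrite /k; case: (ltnP c (size w)) => cw; first by rewrite (drop_nth false cw).
  by rewrite nth_default // !drop_oversize // ltnW.
have [| | |la sl e] := @ex_partition N k T.
- by move=> c; rewrite (kS c); case: (nth _ _ _); lia.
- by rewrite /k drop0.
- by rewrite /k -sw drop_size.
exists la; split=> //; first by rewrite e /k -sw drop_size.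
apply: (@eq_from_nth _ false); first by rewrite size_wseq.
move=> t; rewrite size_wseq => tT; rewrite (nth_map 0) ?size_iota // nth_iota // add0n.
by rewrite /bead !e kS; case: (nth _ _ _); lia.
Qed.

Definition partition0 : partition := @Partition [::] isT.

Definition of_word T (w : seq bool) : partition :=
  xget partition0 [set la : partition | [/\ size la <= N, cnt la T = 0 & wseq la 0 T = w]]%classic.

Lemma of_wordP T w : size w = T -> ones w = N ->
  [/\ size (of_word T w) <= N, cnt (of_word T w) T = 0 & wseq (of_word T w) 0 T = w].
Proof. by move=> sw ow; exact: (xgetPex partition0 (ex_word sw ow)). Qed.

Lemma wseq_inj T (mu la : partition) : size mu <= N -> size la <= N ->
  cnt mu T = 0 -> cnt la T = 0 -> wseq mu 0 T = wseq la 0 T -> mu = la.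
Proof.
move=> s1 s2 c1 c2 e; apply: (eq_bd s1 s2 c1 c2) => t tT.
have := congr1 (fun w => nth false w t) e; rewrite !(nth_map 0) ?size_iota // !nth_iota // add0n.
by have := bd_le1 N mu t; have := bd_le1 N la t; do 2 case: eqP; lia.
Qed.

Definition box T : seq partition := [seq of_word T w | w <- words T & ones w == N].

Lemma mem_box T (la : partition) : (la \in box T) = (size la <= N) && (cnt la T == 0).
Proof.
apply/mapP/andP => [[w]|[sl /eqP lT]].
  rewrite mem_filter => /andP[/eqP ow /size_words sw] ->.
  by have [-> -> _] := of_wordP sw ow.
have ow : ones (wseq la 0 T) = N by rewrite ones_wseq add0n lT cnt0 subn0.
exists (wseq la 0 T); first by rewrite mem_filter ow eqxx -[X in words X](size_wseq la 0) mem_words.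
have [s1 c1 e1] := of_wordP (size_wseq la 0 T) ow.
by apply: (@wseq_inj T).
Qed.

Lemma uniq_box T : uniq (box T).
Proof.
rewrite map_inj_in_uniq ?filter_uniq ?uniq_words // => v w.
rewrite !mem_filter => /andP[/eqP ov /size_words sv] /andP[/eqP ow /size_words sw] e.
by have [_ _ <-] := of_wordP sv ov; have [_ _ <-] := of_wordP sw ow; rewrite e.
Qed.

Lemma sum_box (A : comNzRingType) T (F : partition -> A) (G : seq bool -> A) :
  (forall la, la \in box T -> F la = G (wseq la 0 T)) ->
  (forall w, size w = T -> ones w != N -> G w = 0%R) ->
  (\sum_(la <- box T) F la = \sum_(w <- words T) G w)%R.
Proof.
move=> FG G0; rewrite (eq_big_seq _ FG) big_map big_filter.
rewrite [RHS](bigID (fun w => ones w == N)) /= [X in (_ = _ + X)%R]big_seq_cond.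
rewrite [X in (_ = _ + X)%R]big1 ?addr0; last first.
  by move=> w /andP[/size_words sw ow]; apply: G0.
rewrite big_seq_cond [RHS]big_seq_cond; apply: eq_bigr => w /andP[/size_words sw /eqP ow].
by have [_ _ ->] := of_wordP sw ow.
Qed.

End BeadWords.

Local Open Scope ring_scope.

Definition strip_weight (A : comNzRingType) (q : A) n (mu la : partition) (z : A) : A :=
  if `[< is_horizontal_strip n mu la >] then
    z ^+ #|` strip_tiling n mu la| * q ^+ (\sum_(B <- strip_tiling n mu la) spin B)%N
  else 0.

Section StripWeight.
Variables (N n : nat).
Hypothesis n_gt0 : (0 < n)%N.

Lemma bstrip_ge b mu la k s : bead_strip N n b mu la k s -> bead_strip N n n mu la k s.
Proof.
case: b mu la k s / => [b mu|b h mu mu' la k s bh m H]; first exact: bead_strip0.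
by apply: bead_stripS (m) H; case: m => /andP[].
Qed.

Lemma horizontal_bstrip (mu la : partition) : (size la <= N)%N ->
  is_horizontal_strip n mu la ->
  bead_strip N n 0 mu la #|` strip_tiling n mu la| (\sum_(B <- strip_tiling n mu la) spin B)%N.
Proof.
move=> sl [P tP]; apply: strip_tiling_bstrip => //.
exact: (@xgetPex _ fset0 [set P | is_strip_tiling n mu la P]%classic (ex_intro _ P tP)).
Qed.

Lemma bstrip_horizontal b mu la k s : bead_strip N n b mu la k s -> is_horizontal_strip n mu la.
Proof. by case/(bstrip_strip_tiling n_gt0) => P tP _; exists P. Qed.

Lemma strip_weightE T (A : comNzRingType) (q z : A) (mu la : partition) :
  (size mu <= N)%N -> (size la <= N)%N -> bead_count N mu (n + T) = 0%N -> bead_count N la T = 0%N ->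
  strip_weight q n mu la z = word_weight q z (wseq N mu n T) (wseq N la 0 T) (wseq N mu 0 n).
Proof.
move=> sm sl mT lT; rewrite /strip_weight; case: asboolP => H.
  by rewrite -(word_weight_bstrip (a := 0) (L := T) q z n_gt0 (bstrip_ge (horizontal_bstrip sl H))).
apply/esym/eqP; apply: contraT => Wn0; case: H.
have [k [s]] := word_weight_neq0 (a := 0) n_gt0 sm sl (fun t (h : (t < 0)%N) => False_ind _ (notF h)) mT lT Wn0.
exact: bstrip_horizontal.
Qed.

Section Commutation.
Variables (A : comNzRingType) (q x y : A) (P : nat -> A).
Hypothesis P0 : P 0 = 1.
Hypothesis HP : forall U, P U.+1 = P U + x * y * q ^+ (2 * U) * P U.+1.
Variable I : nat -> A -> Prop.
Hypothesis I0 : forall a, I 0 a.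
Hypothesis Iz : forall k, I k 0.
Hypothesis ID : forall k a b, I k a -> I k b -> I k (a + b).
Hypothesis IM : forall k a b, I k b -> I k (a * b).
Hypothesis Ix : forall k a, I k a -> I k.+1 (x * a).
Hypothesis Iy : forall k a, I k a -> I k.+1 (y * a).

(** The commutation relation up to order [j]. The [n] spare beads of [al] and [be] form the full
    initial state, and the empty positions from [n + L1] on provide the [j] rounds. *)
Lemma comm_box L1 j (al be : partition) : (0 < j)%N ->
  (size al + n <= N)%N -> (size be + n <= N)%N ->
  bead_count N al (n + L1) = 0%N -> bead_count N be (n + L1) = 0%N ->
  let PP := box N (L1 + n * j) in
  I j (\sum_(la <- PP) strip_weight q n al la x * strip_weight q n be la y -
       P n * \sum_(mu <- PP) strip_weight q n mu al y * strip_weight q n mu be x).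
Proof.
move=> j0 sal sbe cal cbe PP; pose T := (L1 + n * j)%N; pose L := (T - n)%N.
have nj : (n <= n * j)%N by rewrite leq_pmulr.
have TL : T = (n + L)%N by rewrite /L /T; lia.
have sal' : (size al <= N)%N by lia.
have sbe' : (size be <= N)%N by lia.
have c0 la : bead_count N la (n + L1) = 0%N -> forall t, (n + L1 <= t)%N -> bead_count N la t = 0%N.
  by move=> c t /(cnt_decr N la); rewrite c leqn0 => /eqP.
have tail la : bead_count N la (n + L1) = 0%N -> wseq N la n L ++ nseq n false = wseq N la n T.
  move=> c; rewrite TL [(n + L)%N]addnC wseqD; congr (_ ++ _).
  rewrite (wseq0 _ c) //; rewrite /L /T; lia.
have ones0 (la : partition) : (size la + n <= N)%N -> wseq N la 0 n = nseq n true.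
  move=> s; apply: (@eq_from_nth _ false); first by rewrite size_wseq size_nseq.
  move=> i; rewrite size_wseq => i_n; rewrite nth_nseq i_n (nth_map 0%N) ?size_iota // nth_iota //.
  by rewrite bd_pad ?eqxx // add0n; lia.
have full la : (size (parts la) + n <= N)%N -> wseq N la 0 T = nseq n true ++ wseq N la n L.
  by move=> s; rewrite TL wseqD ones0.
have dropL la : bead_count N la (n + L1) = 0%N ->
    drop L1 (wseq N la n L ++ nseq n false) = nseq (n * j) false.
  move=> c; rewrite tail // /T wseqD drop_size_cat ?size_wseq //.
  exact: (wseq0 _ c).
have := @words_comm A q x y P HP I I0 Iz ID IM Ix Iy P0 n L L1 j
  (wseq N al n L) (wseq N be n L) n_gt0 (size_wseq _ _ _ _) (size_wseq _ _ _ _).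
rewrite [(L + n)%N]addnC -TL !dropL // => /(_ erefl erefl erefl) /=.
rewrite !tail // -!full //.
rewrite (_ : \sum_(l <- words T) _ = \sum_(la <- PP) strip_weight q n al la x * strip_weight q n be la y).
  rewrite (_ : \sum_(l <- words T) _ = \sum_(mu <- PP) strip_weight q n mu al y * strip_weight q n mu be x) //.
  apply/esym/sum_box => [mu|w sw ow].
    rewrite mem_box => /andP[sm /eqP cm].
    have dr : drop n (wseq N mu 0 T) ++ nseq n false = wseq N mu n T.
      rewrite TL wseqD drop_size_cat ?size_wseq // [(n + L)%N]addnC wseqD; congr (_ ++ _).
      by rewrite (wseq0 _ cm) // -/T TL.
    have tk : take n (wseq N mu 0 T) = wseq N mu 0 n.
      by rewrite TL wseqD take_size_cat ?size_wseq.
    have cm' : bead_count N mu (n + T) = 0%N by have := cnt_decr N mu (leq_addl n T); rewrite cm; lia.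
    rewrite -/T dr tk !(@strip_weightE T) //; rewrite c0 //; rewrite /T; lia.
  apply/eqP; apply: contraNT ow; rewrite -/T => /eqP ne.
  have : word_weight q y (drop n w ++ nseq n false) (wseq N al 0 T) (take n w) != 0.
    by apply/eqP => e; apply: ne; rewrite e mul0r.
  move=> /word_weight_ones; rewrite ones_wseq add0n cnt0 c0 ?subn0 //; last by rewrite /T; lia.
  by rewrite count_cat count_nseq mul0n addn0 -count_cat cat_take_drop => ->.
apply/esym/sum_box => [la|w sw ow].
  rewrite mem_box => /andP[sl /eqP cl].
  by rewrite !(@strip_weightE T) // ?ones0 // c0 //; lia.
apply/eqP; apply: contraNT ow => /eqP ne.
have : word_weight q x (wseq N al n T) w (nseq n true) != 0.
  by apply/eqP => e; apply: ne; rewrite e mul0r.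
move=> /word_weight_ones ->; rewrite -(ones0 al) // -count_cat -wseqD ones_wseq add0n cnt0 c0 ?subn0 //; lia.
Qed.

End Commutation.
End StripWeight.

(** * Power series modulo a monomial *)

Section FpsCongruence.
Variables (R : comNzRingType) (V : choiceType).
Local Notation fpsRV := (fps R V).
Implicit Types (f g : fpsRV) (m a b : {cmonom V}).

Lemma coefD f g a : (f + g) a = f a + g a. Proof. by []. Qed.
Lemma coefN f a : (- f) a = - f a. Proof. by []. Qed.
Lemma coef0 a : (0 : fpsRV) a = 0. Proof. by rewrite /= if_same. Qed.
Lemma coefM f g m a : a \in divisors m -> (f * g) a =
  \sum_(b <- divisors m) \sum_(c <- divisors m | mmul b c == a) f b * g c.
Proof. exact: fps_mulE. Qed.
Lemma coef_sum (J : Type) (r : seq J) (P : pred J) (F : J -> fpsRV) a :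
  (\sum_(i <- r | P i) F i) a = \sum_(i <- r | P i) F i a.
Proof. by apply: (big_morph (fun f : fpsRV => f a)) => //; exact: coef0. Qed.

Lemma divisors_mdeg a m : a \in divisors m -> (mdeg a <= mdeg m)%N.
Proof. by case/divisorsP => b <-; rewrite mdegM leq_addr. Qed.

Definition ord_ge k f := forall a, (mdeg a < k)%N -> f a = 0.

Lemma ord_ge_zero k : ord_ge k 0. Proof. by move=> a _; rewrite coef0. Qed.
Lemma ord_geD k f g : ord_ge k f -> ord_ge k g -> ord_ge k (f + g).
Proof. by move=> hf hg a ak; rewrite coefD hf // hg // addr0. Qed.

Lemma ord_geM k l f g : ord_ge k f -> ord_ge l g -> ord_ge (k + l) (f * g).
Proof.
move=> hf hg a akl; rewrite (coefM _ _ (divisors_id a)) big1 // => b _.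
rewrite big1 // => c /eqP bc; rewrite -bc mdegM in akl.
by case: (ltnP (mdeg b) k) => [/hf ->|bk]; rewrite ?mul0r // hg ?mulr0 //; lia.
Qed.

Lemma ord_geMr k f g : ord_ge k g -> ord_ge k (f * g).
Proof. by rewrite -{2}[k]add0n; exact: ord_geM. Qed.

Lemma ord_geX k f : ord_ge 1 f -> ord_ge k (f ^+ k).
Proof. by move=> hf; elim: k => // k IH; rewrite exprS -add1n; exact: ord_geM. Qed.

Lemma ord_ge_var v : ord_ge 1 (fps_var v : fpsRV).
Proof.
move=> a; rewrite ltnS leqn0 mdeg_eq0 => /eqP -> /=; case: eqP => // e.
by have := congr1 mdeg e; rewrite mdeg1 mdegU.
Qed.

Lemma ord_ge_const f : f mone = 0 -> ord_ge 1 f.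
Proof. by move=> f0 a; rewrite ltnS leqn0 mdeg_eq0 => /eqP ->. Qed.

Lemma ord_ge_sum k (J : eqType) (r : seq J) (P : pred J) (F : J -> fpsRV) :
  (forall i, i \in r -> P i -> ord_ge k (F i)) -> ord_ge k (\sum_(i <- r | P i) F i).
Proof.
move=> h; rewrite big_seq_cond; apply: big_ind => [|f g|i /andP[ir Pi]].
- exact: ord_ge_zero.
- exact: ord_geD.
- exact: h.
Qed.

(* Congruence modulo the series none of whose monomials divides [m]. *)
Definition eqm m f g := forall a, a \in divisors m -> f a = g a.

Lemma eqm_refl m f : eqm m f f. Proof. by []. Qed.
Lemma eqm_sym m f g : eqm m f g -> eqm m g f.
Proof. by move=> h a am; rewrite h. Qed.
Lemma eqm_trans m f g h : eqm m f g -> eqm m g h -> eqm m f h.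
Proof. by move=> h1 h2 a am; rewrite h1 // h2. Qed.
Lemma eqmM m f g f' g' : eqm m f f' -> eqm m g g' -> eqm m (f * g) (f' * g').
Proof.
move=> h1 h2 a am; rewrite !(coefM _ _ am) big_seq [RHS]big_seq.
apply: eq_bigr => b bm; rewrite big_seq_cond [RHS]big_seq_cond; apply: eq_bigr => c /andP[cm _].
by rewrite h1 // h2.
Qed.
Lemma eqmMl m f g g' : eqm m g g' -> eqm m (f * g) (f * g').
Proof. exact: eqmM. Qed.
Lemma eqmMr m f f' g : eqm m f f' -> eqm m (f * g) (f' * g).
Proof. by move=> h; exact: eqmM. Qed.
Lemma eqm_sum m (J : eqType) (r : seq J) (P : pred J) (F G : J -> fpsRV) :
  (forall i, i \in r -> P i -> eqm m (F i) (G i)) ->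
  eqm m (\sum_(i <- r | P i) F i) (\sum_(i <- r | P i) G i).
Proof.
move=> h a am; rewrite !coef_sum big_seq_cond [RHS]big_seq_cond.
by apply: eq_bigr => i /andP[ir Pi]; exact: h.
Qed.
Lemma eqm_prod m (J : eqType) (r : seq J) (P : pred J) (F G : J -> fpsRV) :
  (forall i, i \in r -> P i -> eqm m (F i) (G i)) ->
  eqm m (\prod_(i <- r | P i) F i) (\prod_(i <- r | P i) G i).
Proof.
move=> h; rewrite big_seq_cond [X in eqm _ _ X]big_seq_cond.
apply: (big_ind2 (eqm m)) => [//|f f' g g'|i /andP[ir Pi]]; [exact: eqmM | exact: h].
Qed.

Lemma ord_eqm m f g : ord_ge (mdeg m).+1 (f - g) -> eqm m f g.
Proof.
move=> h a /divisors_mdeg am; apply/eqP; rewrite -subr_eq0; apply/eqP.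
by have := h a; rewrite coefD coefN => ->.
Qed.

Lemma ord_eqm0 m k f : (mdeg m < k)%N -> ord_ge k f -> eqm m f 0.
Proof. by move=> mk h a /divisors_mdeg am; rewrite coef0 h // (leq_ltn_trans am). Qed.

Lemma eqm_var0 m v : m v = 0%N -> eqm m (fps_var v) 0.
Proof.
move=> mv a /divisorsP[b ab]; rewrite coef0 /=; case: eqP => // e.
by move: mv; rewrite -ab e cmM cmUU.
Qed.

Lemma eqm_inv m f f' g g' : f * f' = 1 -> g * g' = 1 -> eqm m f g -> eqm m f' g'.
Proof.
move=> hf hg e; rewrite -[f']mulr1 -hg -[X in eqm _ _ X]mul1r -hf.
rewrite mulrA [f' * g]mulrC [f * f']mulrC; apply: eqmMr; rewrite mulrC.
by apply: eqmMl; exact: eqm_sym.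
Qed.

(** The inverse is the geometric series; its coefficient at [a] is that of a partial sum, since
    powers beyond the degree of [a] do not contribute. *)
Lemma fps_unit1B f : f mone = 0 -> (1 - f) * (1 - f)^-1 = 1.
Proof.
move=> f0; have of1 := ord_ge_const f0.
pose S k := \sum_(i < k) f ^+ i.
pose g : fpsRV := FPS (fun a => S (mdeg a).+1 a).
have gS m : eqm m g (S (mdeg m).+1).
  move=> a /divisors_mdeg am; rewrite /= /S !coef_sum.
  rewrite -(subnKC (am : mdeg a < (mdeg m).+1)%N) big_split_ord /=.
  rewrite [X in _ = _ + X]big1 ?addr0 // => i _.
  by rewrite (ord_geX of1) // ltn_addr.
suff gf : g * (1 - f) = 1 by apply: mulrV; exact: fps_unitP gf.
apply/fpsP => m; rewrite (eqmMr (1 - f) (gS m) (divisors_id m)).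
have -> : S (mdeg m).+1 * (1 - f) = 1 - f ^+ (mdeg m).+1.
  by rewrite -[1 - f ^+ _]opprB subrX1 -mulNr opprB mulrC.
by rewrite coefD coefN (ord_geX of1) // subr0.
Qed.

End FpsCongruence.

(** * The Cauchy identity *)

Lemma sumn_bounds (la : partition) : (size la <= sumn la)%N /\ (row la 0 <= sumn la)%N.
Proof.
have gt0 : all (ltn 0) la by apply/(all_nthP 0%N) => i; rewrite /= -row_gt0.
case: la gt0 => s /= _ gt0; split; last by case: s gt0 => //= a s _; exact: leq_addr.
elim: s gt0 => //= a s IH /andP[a0 /IH h].
by rewrite -addn1 addnC leq_add.
Qed.

Lemma sum_delta (A : comNzRingType) (I : eqType) (r : seq I) i (F : I -> A) :
  uniq r -> i \in r -> \sum_(j <- r) F j * (j == i)%:R = F i.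
Proof.
move=> ur ir; rewrite (bigD1_seq i) //= eqxx mulr1 big1 ?addr0 // => j /negbTE ->.
exact: mulr0.
Qed.

Lemma bstrip_none N n b mu la k s : bead_strip N n b mu la k s -> k = 0%N -> mu = la /\ s = 0%N.
Proof. by case. Qed.

Section StripFacts.
Variables (n : nat) (n_gt0 : (0 < n)%N).

Lemma strip_sumn (mu la : partition) : is_horizontal_strip n mu la ->
  sumn la = (sumn mu + n * #|` strip_tiling n mu la|)%N.
Proof. by move=> H; exact: (bstrip_sumn (horizontal_bstrip n_gt0 (leqnn _) H)). Qed.

Lemma strip_contained (mu la : partition) : is_horizontal_strip n mu la -> contained mu la.
Proof. by case=> P []. Qed.

Lemma strip_refl la : is_horizontal_strip n la la.
Proof. exact: (bstrip_horizontal n_gt0 (bead_strip0 0 n 0 la)). Qed.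

Lemma strip_tiling_neq (mu la : partition) : is_horizontal_strip n mu la -> mu != la ->
  (0 < #|` strip_tiling n mu la|)%N.
Proof.
move=> H; apply: contraNT; rewrite -leqNgt leqn0 => /eqP k0.
by have [->] := bstrip_none (horizontal_bstrip n_gt0 (leqnn _) H) k0.
Qed.

Section Weight.
Variables (A : comNzRingType) (q : A).

Lemma strip_weight_refl la z : strip_weight q n la la z = 1.
Proof.
rewrite /strip_weight; case: asboolP => [H|]; last by case; exact: strip_refl.
have k0 : #|` strip_tiling n la la| = 0%N.
  by have := strip_sumn H; case: #|` _| => // k; rewrite mulnS; lia.
have [_ s0] := bstrip_none (horizontal_bstrip n_gt0 (leqnn _) H) k0.
by rewrite k0 s0 !expr0 mulr1.
Qed.

Lemma strip_weight_core al de z : irreducible_ribbon n de ->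
  strip_weight q n al de z = (al == de)%:R.
Proof.
move=> irr; case: eqP => [->|ne]; first exact: strip_weight_refl.
rewrite /strip_weight; case: asboolP => // H.
by have [/ne] := bstrip_irreducible (horizontal_bstrip n_gt0 (leqnn _) H) irr.
Qed.

Lemma strip_weight_neq0 al la z : strip_weight q n al la z != 0 ->
  is_horizontal_strip n al la.
Proof. by rewrite /strip_weight; case: asboolP; rewrite ?eqxx. Qed.
End Weight.
End StripFacts.

Section Cauchy.
Variables (n : nat) (n_gt0 : (0 < n)%N) (V : choiceType).
Local Notation R := (fps {poly int} V).
Notation q := (fps_q : R).

Definition cauchy_kernel (U : nat) (x y : R) : R :=
  \prod_(k < U) (1 - x * y * q ^+ (2 * k))^-1.

Lemma kernel_inv (u v : V) (k : nat) :
  let z := fps_var u * fps_var v * q ^+ (2 * k) in (1 - z) * (1 - z)^-1 = 1.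
Proof.
apply: fps_unit1B; have : ord_ge 1 (fps_var u * fps_var v * q ^+ (2 * k)).
  by rewrite mulrC mulrA; apply: ord_geMr; exact: ord_ge_var.
by apply; rewrite mdeg1.
Qed.

Lemma kernelS (u v : V) U : let x := fps_var u in let y := fps_var v in
  cauchy_kernel U.+1 x y = cauchy_kernel U x y + x * y * q ^+ (2 * U) * cauchy_kernel U.+1 x y.
Proof.
move=> x y; rewrite /cauchy_kernel big_ord_recr /=; have := kernel_inv u v U.
rewrite /= -/x -/y; set z := x * y * _; move: (1 - z)^-1 => i e.
by rewrite -[X in _ = X + _]mulr1 -e; ring.
Qed.

Variable m : {cmonom V}.
Variable de : partition.
Hypothesis de_core : irreducible_ribbon n de.

(* All partitions that contribute to the coefficients of divisors of [m] have
   size at most [size_bound]; with [nbeads] beads the first [n] of them stay in place. *)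
Definition size_bound := (sumn de + n * mdeg m)%N.
Definition nbeads := (size_bound + n)%N.
(** The sum of the first two terms is [L1] in [comm_box]: small partitions have no bead from
    [n + L1] on. The rest provides [(mdeg m).+1] empty rounds, so that the error has order above the
    degree of [m]. *)
Definition width := (size_bound + size_bound + n * (mdeg m).+1)%N.
Notation N := nbeads.
Notation T := width.
Notation PP := (box N T).
Notation sw := (strip_weight q n).

Lemma small_bounds (la : partition) : (sumn la <= size_bound)%N ->
  (size la + n <= N)%N /\ bead_count N la (n + (size_bound + size_bound)) = 0%N.
Proof.
move=> sm; have [a b] := sumn_bounds la; split; first by rewrite /nbeads; lia.
apply/eqP; rewrite -leqn0 leqNgt; apply/negP => h.
have N0 : (0 < N)%N by rewrite /nbeads; lia.
by move: h; rewrite ltn_cnt // /nbeads; lia.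
Qed.

Lemma small_box (la : partition) : (sumn la <= size_bound)%N -> la \in PP.
Proof.
move=> /small_bounds[a b]; rewrite mem_box; apply/andP; split; first by lia.
have nT : (n + (size_bound + size_bound) <= T)%N by rewrite /width mulnS; lia.
by have := cnt_decr N la nT; rewrite b leqn0.
Qed.

Lemma de_small : (sumn de <= size_bound)%N. Proof. exact: leq_addr. Qed.

Lemma box_contained (mu la : partition) : contained mu la -> la \in PP -> mu \in PP.
Proof.
move=> c; rewrite !mem_box => /andP[sl /eqP cl]; apply/andP; split.
  exact: leq_trans (contained_size c) sl.
by apply/eqP; exact: contained_cnt0 c sl cl.
Qed.

Section Chains.
Variable Z : nat -> V.
Notation z i := (fps_var (Z i) : R).

(** The ribbon function of [la / de] in the first [r] variables, with empty strips allowed. For [la]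
    in the box, confining [al] to the box loses nothing, as the box is closed under containment. *)
Fixpoint chain_sum (r : nat) (la : partition) : R :=
  if r is r'.+1 then \sum_(al <- PP) chain_sum r' al * sw al la (z r') else (la == de)%:R.

(** Each ribbon contributes one variable. The inequality says, without subtraction, that [k - 1]
    ribbons are too few to get from [de] to [la]. *)
Lemma strip_ord (mu la : partition) i k (f : R) : is_horizontal_strip n mu la ->
  (sumn de + n * k < sumn la + n)%N ->
  (forall k', (sumn de + n * k' < sumn mu + n)%N -> ord_ge k' f) ->
  ord_ge k (f * sw mu la (z i)).
Proof.
move=> H h IH; rewrite /strip_weight; case: asboolP => // _.
have := strip_sumn n_gt0 H; set c := #|` _| => e.
have oc : ord_ge c (z i ^+ c * q ^+ (\sum_(B <- strip_tiling n mu la) spin B)%N).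
  by rewrite mulrC; apply: ord_geMr; apply: ord_geX; exact: ord_ge_var.
case: (leqP k c) => kc; first by move=> a ak; apply: (ord_geMr _ oc); apply: leq_trans ak kc.
rewrite -(subnK (ltnW kc)); apply: ord_geM => //; apply: IH.
by move: h; rewrite e -[in X in (X < _)%N](subnK (ltnW kc)) mulnDr; lia.
Qed.

Lemma chain_sum_ord r la k : (sumn de + n * k < sumn (parts la) + n)%N -> ord_ge k (chain_sum r la).
Proof.
elim: r la k => [|r IH] la k h /=.
  case: eqP => [e|_]; last exact: ord_ge_zero.
  by case: k h => // k; rewrite e mulnS; lia.
apply: ord_ge_sum => al _ _.
have [H|H] := pselect (is_horizontal_strip n al la).
  by apply: strip_ord => // k' h'; apply: IH.
by rewrite /strip_weight; case: asboolP => // _; rewrite mulr0; exact: ord_ge_zero.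
Qed.

Lemma chain_sum_big r la : (size_bound < sumn (parts la))%N -> eqm m (chain_sum r la) 0.
Proof.
move=> h; apply: (@ord_eqm0 _ _ _ (mdeg m).+1) => //; apply: chain_sum_ord.
by rewrite mulnS; move: h; rewrite /size_bound; lia.
Qed.

Lemma chain_sum_de r : chain_sum r de = 1.
Proof.
elim: r => [|r IH] /=; first by rewrite eqxx.
under eq_bigr do rewrite (strip_weight_core n_gt0 _ _ _ de_core).
by rewrite sum_delta ?uniq_box ?small_box ?de_small.
Qed.

(** Strips preserve the runner counts, so every partition reached from [de] has its residues, and
    eventually its core. *)
Lemma chain_sum_residues r la : la \in PP -> chain_sum r la != 0 -> same_residues N n T de la.
Proof.
elim: r la => [|r IH] la laP /=; first by case: (la =P de) => [->|] //; rewrite eqxx.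
move=> ne; have [al alP] : exists2 al, al \in PP & chain_sum r al * sw al la (z r) != 0.
  apply: contrapT => no; case/eqP: ne; rewrite big_seq big1 // => al alP.
  by apply/eqP; apply: contrapT => /negP h; apply: no; exists al.
move=> h; have h1 : chain_sum r al != 0 by apply: contraNneq h => ->; rewrite mul0r.
have /strip_weight_neq0 H : sw al la (z r) != 0 by apply: contraNneq h => ->; rewrite mulr0.
move=> x xn; rewrite (IH al) //; move: laP; rewrite mem_box => /andP[sl /eqP cl].
exact: (bstrip_residues (horizontal_bstrip n_gt0 sl H) sl cl).
Qed.

End Chains.

Lemma chain_sum_eigen (u : V) (Y : nat -> V) s al : (sumn (parts al) <= size_bound)%N ->
  eqm m (\sum_(la <- PP) sw al la (fps_var u) * chain_sum Y s la)
        ((\prod_(j < s) cauchy_kernel n (fps_var u) (fps_var (Y j))) * chain_sum Y s al).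
Proof.
elim: s al => [|s IH] al sal.
  rewrite big_ord0 [X in eqm _ X _]/= sum_delta ?uniq_box ?small_box ?de_small //.
  rewrite (strip_weight_core n_gt0 _ _ _ de_core) mul1r; exact: eqm_refl.
set x := fps_var u; pose y := fps_var (Y s) : R; pose K := cauchy_kernel n x y.
set Pi := \prod_(j < s.+1) _.
(* Splitting off the last strip, from [be] to [la], exhibits the matrix entry of [D(y) U(x)] between
   [al] and [be]. *)
have -> : \sum_(la <- PP) sw al la x * chain_sum Y s.+1 la =
    \sum_(be <- PP) chain_sum Y s be * \sum_(la <- PP) sw al la x * sw be la y.
  rewrite [LHS](eq_bigr _ (fun la _ => mulr_sumr _ _ _ _)) exchange_big.
  apply: eq_bigr => be _; rewrite mulr_sumr; apply: eq_bigr => la _.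
  by rewrite mulrCA.
apply: (@eqm_trans _ _ _ _ (\sum_(be <- PP) chain_sum Y s be *
    (K * \sum_(mu <- PP) sw mu al y * sw mu be x))).
  (* For large [be] the factor [chain_sum Y s be] vanishes modulo [m]; for small [be] the relation
     [comm_box] applies. *)
  apply: eqm_sum => be _ _; case: (leqP (sumn be) size_bound) => sbe; last first.
    have h := chain_sum_big Y s sbe.
    apply: (eqm_trans (eqmMr _ h)); rewrite mul0r; apply: eqm_sym.
    by rewrite -[X in eqm _ _ X](mul0r (K * \sum_(mu <- PP) sw mu al y * sw mu be x)); apply: eqmMr.
  apply: eqmMl; apply: ord_eqm.
  have [a1 a2] := small_bounds sal; have [b1 b2] := small_bounds sbe.
  apply: (@comm_box N n n_gt0 R q x y (fun U => cauchy_kernel U x y) _ _ (@ord_ge _ V)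
    _ _ _ _ _ _ (size_bound + size_bound) (mdeg m).+1 al be) => //.
  - by rewrite /cauchy_kernel big_ord0.
  - by move=> U; exact: kernelS.
  - exact: ord_ge_zero.
  - exact: ord_geD.
  - exact: ord_geMr.
  - by move=> k a; exact: (ord_geM (@ord_ge_var _ _ u)).
  - by move=> k a; exact: (ord_geM (@ord_ge_var _ _ (Y s))).
have -> : \sum_(be <- PP) chain_sum Y s be * (K * \sum_(mu <- PP) sw mu al y * sw mu be x) =
    K * \sum_(mu <- PP) sw mu al y * \sum_(be <- PP) sw mu be x * chain_sum Y s be.
  rewrite mulr_sumr.
  under [RHS]eq_bigr do rewrite mulrA mulr_sumr.
  rewrite exchange_big; apply: eq_bigr => be _.
  rewrite !mulr_sumr; apply: eq_bigr => mu _.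
  by rewrite mulrC -!mulrA.
have -> : Pi = \prod_(j < s) cauchy_kernel n x (fps_var (Y j)) * K by rewrite /Pi big_ord_recr.
set Pj := \prod_(j < s) _.
(* Only [mu] contained in [al] contribute, so they meet the size bound of the induction
   hypothesis. *)
apply: (@eqm_trans _ _ _ _ (K * \sum_(mu <- PP) sw mu al y * (Pj * chain_sum Y s mu))).
  apply: eqmMl; apply: eqm_sum => mu _ _.
  have [H|H] := pselect (is_horizontal_strip n mu al); last first.
    by rewrite /strip_weight; case: asboolP => // _; rewrite !mul0r; exact: eqm_refl.
  apply: eqmMl; apply: IH; apply: leq_trans sal.
  by rewrite (strip_sumn n_gt0 H) leq_addr.
rewrite [Pj * K]mulrC -mulrA; apply: eqmMl.
rewrite [chain_sum Y s.+1 al]/= mulr_sumr.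
rewrite (_ : \sum_(mu <- PP) _ = \sum_(i <- PP) Pj * (chain_sum Y s i * sw i al y)); first exact: eqm_refl.
by apply: eq_bigr => mu _; rewrite mulrCA [sw _ _ _ * _]mulrC.
Qed.

(** Splitting off the last strip in the [X] variables leaves a sum to which [chain_sum_eigen]
    applies, with an eigenvalue independent of [al]. With no [X] variable, only [la = de] is
    left. *)
Lemma chain_sum_cauchy (X Y : nat -> V) r s :
  eqm m (\sum_(la <- PP) chain_sum X r la * chain_sum Y s la)
        (\prod_(i < r) \prod_(j < s) cauchy_kernel n (fps_var (X i)) (fps_var (Y j))).
Proof.
elim: r => [|r IH].
  rewrite big_ord0 [X in eqm _ X _]/=.
  under [X in eqm _ X _]eq_bigr do rewrite mulrC.
  by rewrite sum_delta ?uniq_box ?small_box ?de_small // chain_sum_de; exact: eqm_refl.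
have -> : \sum_(la <- PP) chain_sum X r.+1 la * chain_sum Y s la =
    \sum_(al <- PP) chain_sum X r al * \sum_(la <- PP) sw al la (fps_var (X r)) * chain_sum Y s la.
  rewrite [LHS](eq_bigr _ (fun la _ => mulr_suml _ _ _ _)) exchange_big.
  by apply: eq_bigr => al _; rewrite mulr_sumr; apply: eq_bigr => la _; rewrite mulrA.
pose F i := \prod_(j < s) cauchy_kernel n (fps_var (X i)) (fps_var (Y j)).
rewrite -[X in eqm _ _ X]/(\prod_(i < r.+1) F i).
have -> : \prod_(i < r.+1) F i = \prod_(i < r) F i * F r by rewrite big_ord_recr.
have [K FK] : {K | K = F r} by exists (F r).
rewrite -FK.
apply: (@eqm_trans _ _ _ _ (K * \sum_(al <- PP) chain_sum X r al * chain_sum Y s al)); last first.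
  by rewrite mulrC; apply: eqmMr.
rewrite mulr_sumr; apply: eqm_sum => al _ _.
rewrite [X in eqm _ _ X]mulrCA.
case: (leqP (sumn al) size_bound) => sal; first by apply: eqmMl; rewrite FK; exact: chain_sum_eigen.
have h := chain_sum_big X r sal.
apply: (eqm_trans (eqmMr _ h)); rewrite mul0r; apply: eqm_sym.
by rewrite -[X in eqm _ _ X](mul0r (K * chain_sum Y s al)); apply: eqmMr.
Qed.

End Cauchy.

(** * Ribbon functions as finite sums over chains of strips *)

Section Tableaux.
Variables (n : nat) (n_gt0 : (0 < n)%N) (V : choiceType).
Local Notation R := (fps {poly int} V).
Notation q := (fps_q : R).
Variables (m : {cmonom V}) (de : partition) (Z : nat -> V).
Notation N := (nbeads n m de).
Notation PP := (box N (width n m de)).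
Notation sw := (strip_weight q n).
Notation z i := (fps_var (Z i) : R).
Notation strip := (is_horizontal_strip n).

Definition tableau_term (T : seq partition) : R :=
  q ^+ tableau_spin n de T *
  \prod_(i < size T) z i ^+ nth 0%N (tableau_weight n de T) i.

Definition strips (T : seq partition) :=
  forall p, p \in chain_steps de T -> strip p.1 p.2.

Lemma chain_steps_rcons mu T la :
  chain_steps mu (rcons T la) = rcons (chain_steps mu T) (last mu T, la).
Proof. by elim: T mu => //= a T IH mu; rewrite /chain_steps /= -IH. Qed.

Lemma size_chain_steps mu T : size (chain_steps mu T) = size T.
Proof. by rewrite /chain_steps size_zip /=; apply/minn_idPr. Qed.

Lemma stripsE T la : strips (rcons T la) <-> strips T /\ strip (last de T) la.
Proof.
rewrite /strips chain_steps_rcons; split=> [h|[h1 h2] p].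
  split=> [p pT|]; first by apply: h; rewrite mem_rcons inE pT orbT.
  by apply: (h (last de T, la)); rewrite mem_rcons inE eqxx.
by rewrite mem_rcons inE => /orP[/eqP->|/h1].
Qed.

Lemma tableau_term_rcons T la : strip (last de T) la ->
  tableau_term (rcons T la) = tableau_term T * sw (last de T) la (z (size T)).
Proof.
move=> H; rewrite /strip_weight; case: asboolP => // _; rewrite /tableau_term.
have -> : tableau_spin n de (rcons T la) =
    (tableau_spin n de T + \sum_(B <- strip_tiling n (last de T) la) spin B)%N.
  by rewrite /tableau_spin chain_steps_rcons -cats1 big_cat big_seq1.
have -> : tableau_weight n de (rcons T la) =
    rcons (tableau_weight n de T) #|` strip_tiling n (last de T) la|.
  by rewrite /tableau_weight chain_steps_rcons map_rcons.
have sT : size (tableau_weight n de T) = size T by rewrite size_map size_chain_steps.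
have -> : \prod_(i < size (rcons T la)) z i ^+
    nth 0%N (rcons (tableau_weight n de T) #|` strip_tiling n (last de T) la|) i =
   \prod_(i < size T) z i ^+ nth 0%N (tableau_weight n de T) i *
   z (size T) ^+ #|` strip_tiling n (last de T) la|.
  rewrite size_rcons big_ord_recr /= nth_rcons sT ltnn eqxx; congr (_ * _).
  by apply: eq_bigr => i _; rewrite nth_rcons sT ltn_ord.
by rewrite exprD -!mulrA; congr (_ * _); rewrite mulrCA; congr (_ * _); rewrite mulrC.
Qed.

Lemma tableau_term_nil : tableau_term [::] = 1.
Proof. by rewrite /tableau_term big_ord0 mulr1 /tableau_spin big_nil expr0. Qed.

Lemma tableau_term_ord T k : strips T -> (sumn de + n * k < sumn (parts (last de T)) + n)%N ->
  ord_ge k (tableau_term T).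
Proof.
elim/last_ind: T k => [|T la IH] k sT.
  by case: k => [//|k] /=; rewrite mulnS; lia.
rewrite last_rcons => h; have [sT' H] := (stripsE T la).1 sT.
rewrite tableau_term_rcons //; apply: (@strip_ord n n_gt0 V de Z) => //.
by move=> k'; apply: IH.
Qed.

Lemma strips_contained T x : strips T -> x \in de :: T -> contained x (last de T).
Proof.
elim/last_ind: T => [|T la IH] sT; first by rewrite inE => /eqP ->; exact/containedP.
have [sT' H] := (stripsE T la).1 sT.
rewrite last_rcons -rcons_cons mem_rcons inE => /orP[/eqP->|/(IH sT') c]; first exact/containedP.
apply/containedP => i; apply: leq_trans (containedP _ _ c i) _.
exact: (containedP _ _ (strip_contained H)).
Qed.

(* [chains r] has exactly [r] strips, [tableaux r] at most [r] and no trailing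
   empty one; both carry the same total weight. *)
Fixpoint chains (r : nat) (la : partition) : seq (seq partition) :=
  if r is r'.+1 then
    [seq rcons T la | al <- [seq al <- PP | `[< strip al la >]], T <- chains r' al]
  else if la == de then [:: [::]] else [::].

Fixpoint tableaux (r : nat) (la : partition) : seq (seq partition) :=
  if r is r'.+1 then tableaux r' la ++
    [seq rcons T la | al <- [seq al <- PP | `[< strip al la >] & al != la], T <- chains r' al]
  else if la == de then [:: [::]] else [::].

Lemma mem_chains r la T : la \in PP ->
  T \in chains r la <-> [/\ size T = r, last de T = la & strips T].
Proof.
elim: r la T => [|r IH] la T laP /=.
  case: eqP => [->|ne]; last by split=> // -[/size0nil -> /esym].
  by rewrite inE; split=> [/eqP->|[/size0nil->]] //; split=> // p; rewrite /chain_steps.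
split.
  case/allpairsPdep => al [T' []]; rewrite mem_filter => /andP[/asboolP H alP].
  move=> /(IH _ _ alP)[s l sT] ->; rewrite size_rcons last_rcons s; split=> //.
  by apply/stripsE; rewrite l.
case/lastP: T => [|T la'] [] //; rewrite size_rcons last_rcons => -[s] -> /stripsE[sT H].
have lP : last de T \in PP by apply: box_contained (strip_contained H) laP.
apply/allpairsPdep; exists (last de T), T; split=> //.
  by rewrite mem_filter lP andbT; apply/asboolP.
exact/(IH _ _ lP).
Qed.

(** A chain is increasing, so its last partition occurs earlier only if the last strip is empty. *)
Lemma mem_tableaux r la T : la \in PP ->
  T \in tableaux r la <-> (size T <= r)%N /\ is_ribbon_tableau n la de T.
Proof.
move=> laP; have tabE T' : is_ribbon_tableau n la de (rcons T' la) <->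
    [/\ strips T', strip (last de T') la & last de T' != la].
  rewrite /is_ribbon_tableau last_rcons belast_rcons; split.
    case=> /stripsE[sT H] _ ne; split=> //.
    by apply: contraNneq ne => <-; rewrite mem_last.
  case=> sT H ne; split=> //; first exact/stripsE.
  apply/negP => /(strips_contained sT) c; case/eqP: ne.
  exact: contained_anti (strip_contained H) c.
have nilE T' : (size T' <= 0)%N /\ is_ribbon_tableau n la de T' <-> la = de /\ T' = [::].
  rewrite leqn0; split=> [[/nilP->]|[-> ->]]; first by case=> _ /= <- _.
  by split=> //; split=> // p; rewrite /chain_steps.
elim: r T => [|r IH] T /=.
  rewrite nilE; case: eqP => [->|ne]; last by split=> // -[].
  by rewrite inE; split=> [/eqP->|[_ ->]].
rewrite mem_cat; split.
  case/orP => [/IH[s t]|].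
    by split=> //; exact: leqW.
  case/allpairsPdep => al [T' []]; rewrite mem_filter => /andP[/andP[/asboolP H ne] alP].
  by move=> /(mem_chains _ _ alP)[s l sT] ->; rewrite size_rcons s; split=> //; apply/tabE; rewrite l.
case; rewrite leq_eqVlt ltnS => /orP[/eqP s|s] t; last by apply/orP; left; apply/IH.
case/lastP: T s t => [//|T la']; rewrite size_rcons => -[s] t.
have e : la' = la by case: t => _ + _; rewrite last_rcons.
rewrite e in t *; apply/orP; right; have [sT H ne] := (tabE T).1 t.
have lP : last de T \in PP by apply: box_contained (strip_contained H) laP.
apply/allpairsPdep; exists (last de T), T; split=> //.
  by rewrite mem_filter lP ne !andbT; apply/asboolP.
exact/(mem_chains _ _ lP).
Qed.

Lemma uniq_chains r la : la \in PP -> uniq (chains r la).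
Proof.
elim: r la => [|r IH] la laP /=; first by case: ifP.
apply: allpairs_uniq_dep; first by rewrite filter_uniq ?uniq_box.
  by move=> al; rewrite mem_filter => /andP[_ /IH].
move=> u v /allpairsPdep[a [T [+ aT ->]]] /allpairsPdep[a' [T' [+ aT' ->]]] /= /rcons_inj[e].
rewrite !mem_filter => /andP[_ aP] /andP[_ aP']; subst T'.
by have [_ <- _] := (mem_chains _ _ aP).1 aT; have [_ <- _] := (mem_chains _ _ aP').1 aT'.
Qed.

Lemma uniq_tableaux r la : la \in PP -> uniq (tableaux r la).
Proof.
move=> laP; elim: r => [|r IH] /=; first by case: ifP.
rewrite cat_uniq IH /=; apply/andP; split.
  apply/hasPn => T0 /allpairsPdep[al [T []]]; rewrite mem_filter => /andP[_ alP].
  move=> /(mem_chains _ _ alP)[s _ _] ->; apply/negP => /(mem_tableaux _ _ laP)[].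
  by rewrite size_rcons s ltnn.
apply: allpairs_uniq_dep; first by rewrite filter_uniq ?uniq_box.
  by move=> al; rewrite mem_filter => /andP[_ /uniq_chains].
move=> u v /allpairsPdep[a [T [+ aT ->]]] /allpairsPdep[a' [T' [+ aT' ->]]] /= /rcons_inj[e].
rewrite !mem_filter => /andP[_ aP] /andP[_ aP']; subst T'.
by have [_ <- _] := (mem_chains _ _ aP).1 aT; have [_ <- _] := (mem_chains _ _ aP').1 aT'.
Qed.

Lemma sum_chains_rcons r la al : al \in PP -> strip al la ->
  \sum_(T <- chains r al) tableau_term (rcons T la) =
  (\sum_(T <- chains r al) tableau_term T) * sw al la (z r).
Proof.
move=> alP H; rewrite mulr_suml big_seq [RHS]big_seq; apply: eq_bigr => T.
by move=> /(mem_chains _ _ alP)[s l _]; rewrite tableau_term_rcons l ?s.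
Qed.

Lemma sw_nstrip al la x : ~ strip al la -> sw al la x = 0.
Proof. by move=> h; rewrite /strip_weight; case: asboolP. Qed.

Lemma sum_chains r la : la \in PP -> \sum_(T <- chains r la) tableau_term T = chain_sum n m de Z r la.
Proof.
elim: r la => [|r IH] la laP /=.
  case: eqP => _; last by rewrite big_nil.
  by rewrite big_seq1 tableau_term_nil.
rewrite big_allpairs_dep big_filter big_mkcond big_seq [RHS]big_seq; apply: eq_bigr => al alP.
case: asboolP => H; last by rewrite sw_nstrip // mulr0.
by rewrite sum_chains_rcons // IH.
Qed.

(** The term [al = la] of [chain_sum] is an empty last strip, of weight 1; it accounts for the
    shorter tableaux. *)
Lemma sum_tableaux r la : la \in PP -> \sum_(T <- tableaux r la) tableau_term T = chain_sum n m de Z r la.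
Proof.
move=> laP; elim: r => [|r IH] /=.
  case: eqP => _; last by rewrite big_nil.
  by rewrite big_seq1 tableau_term_nil.
rewrite big_cat IH /= [RHS](bigD1_seq la) ?uniq_box //= strip_weight_refl // mulr1.
congr (_ + _); rewrite big_allpairs_dep big_filter big_mkcond big_seq.
rewrite [RHS]big_mkcond [RHS]big_seq; apply: eq_bigr => al alP.
case: asboolP => H /=; last by case: ifP => _ //; rewrite sw_nstrip // mulr0.
by case: ifP => _ //; rewrite sum_chains_rcons // sum_chains.
Qed.

(** The last strip is nonempty and carries a variable of index at least [r], which does not occur in
    [m]. *)
Lemma tableau_term_eq0 r la T : (forall i, (r <= i)%N -> m (Z i) = 0%N) ->
  is_ribbon_tableau n la de T -> (r < size T)%N -> eqm m (tableau_term T) 0.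
Proof.
move=> hr; case/lastP: T => [|T la'] //; rewrite size_rcons ltnS => -[+ + +] rT.
rewrite last_rcons => /stripsE[sT H] e; rewrite belast_rcons {}e in H * => ne.
have ne' : last de T != la by apply: contraNneq ne => <-; rewrite mem_last.
rewrite tableau_term_rcons // /strip_weight; case: asboolP => // _.
have := strip_tiling_neq n_gt0 H ne'; case: #|` _| => // k _.
have h0 : eqm m (z (size T)) 0 by apply: eqm_var0; exact: hr.
rewrite exprS -mulrA mulrCA; apply: (eqm_trans (eqmMr _ h0)); rewrite mul0r; exact: eqm_refl.
Qed.

Lemma ribbon_function_chain_sum r la : la \in PP -> (forall i, (r <= i)%N -> m (Z i) = 0%N) ->
  eqm m (ribbon_function n Z la de) (chain_sum n m de Z r la).
Proof.
move=> laP hr a am; rewrite -sum_tableaux // coef_sum.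
rewrite -[LHS]/(\sum_(T \in [set T | is_ribbon_tableau n la de T]%classic) tableau_term T a).
rewrite (@fsbigE _ _ _ _ _ (tableaux r la)); first 1 last.
- exact: uniq_tableaux.
- by move=> T /= /(mem_tableaux _ _ laP)[].
- move=> T tT nT; case: (leqP (size T) r) => sT.
    by case/negP: nT; apply/(mem_tableaux _ _ laP).
  by rewrite (tableau_term_eq0 hr tT sT am) coef0.
rewrite big_seq_cond [RHS]big_seq; apply: eq_big => T.
  by apply: andb_idr => /(mem_tableaux _ _ laP)[_ h]; apply/mem_set.
by [].
Qed.

Lemma ribbon_function_big la : (size_bound n m de < sumn (parts la))%N ->
  eqm m (ribbon_function n Z la de) 0.
Proof.
move=> big a am; rewrite coef0.
rewrite -[LHS]/(\sum_(T \in [set T | is_ribbon_tableau n la de T]%classic) tableau_term T a).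
apply: fsbig1 => T [sT lT _].
have o : ord_ge (mdeg m).+1 (tableau_term T).
  by apply: tableau_term_ord => //; rewrite lT; move: big; rewrite /size_bound mulnS; lia.
by apply: o; rewrite ltnS; exact: divisors_mdeg.
Qed.

End Tableaux.

Local Open Scope classical_set_scope.
Local Open Scope ring_scope.

(** * Comparison of the coefficients of a fixed monomial *)

Section Final.
Variables (n : nat) (n_gt0 : (0 < n)%N) (de : partition).
Hypothesis de_core : is_ncore n de.
Local Notation V := (nat + nat)%type.
Local Notation R := (fps {poly int} V).

Definition cauchy_term (la : partition) : R :=
  core_ribbon_function n xvar la * core_ribbon_function n yvar la.

Variable m : {cmonom V}.
Notation PP := (box (nbeads n m de) (width n m de)).

Lemma cauchy_term_out la : ncore n la = de -> la \notin PP -> eqm m (cauchy_term la) 0.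
Proof.
move=> cla laP; have big : (size_bound n m de < sumn (parts la))%N.
  by rewrite ltnNge; apply: contra laP; exact: small_box.
rewrite /cauchy_term /core_ribbon_function cla.
have h := ribbon_function_big n_gt0 xvar big.
by rewrite -[X in eqm _ _ X](mul0r (ribbon_function n yvar la de)); apply: eqmMr.
Qed.

Lemma cauchy_term_in r la : ncore n la = de -> la \in PP ->
  (forall i, (r <= i)%N -> m (xvar i) = 0%N /\ m (yvar i) = 0%N) ->
  eqm m (cauchy_term la) (chain_sum n m de xvar r la * chain_sum n m de yvar r la).
Proof.
move=> cla laP hr; rewrite /cauchy_term /core_ribbon_function cla.
by apply: eqmM; apply: ribbon_function_chain_sum => // i /hr[].
Qed.

Lemma chain_sum_ncore (Z : nat -> V) r la : la \in PP -> chain_sum n m de Z r la != 0 -> ncore n la = de.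
Proof.
move=> laP ne; have irr := ncore_irreducible n_gt0 de_core.
have deP := small_box n_gt0 (de_small n m de).
have := laP; have := deP; rewrite !mem_box => /andP[sd /eqP cd] /andP[sl /eqP cl].
exact: (ncore_residues n_gt0 irr sd sl cd cl (chain_sum_residues n_gt0 laP ne)).
Qed.

Lemma cauchy_sum r : (forall i, (r <= i)%N -> m (xvar i) = 0%N /\ m (yvar i) = 0%N) ->
  fps_sum [set la | ncore n la = de] cauchy_term m =
  (\prod_(i < r) \prod_(j < r) cauchy_kernel n (fps_var (xvar i)) (fps_var (yvar j))) m.
Proof.
move=> hr; have irr := ncore_irreducible n_gt0 de_core.
have mm := divisors_id m.
rewrite -(chain_sum_cauchy n_gt0 irr xvar yvar r r mm) coef_sum.
rewrite -[LHS]/(\sum_(la \in [set la | ncore n la = de]) cauchy_term la m).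
rewrite (@fsbigE _ _ _ _ _ [seq la <- PP | ncore n la == de]); first 1 last.
- by rewrite filter_uniq ?uniq_box.
- by move=> la /=; rewrite mem_filter => /andP[/eqP].
- move=> la cla; rewrite mem_filter cla eqxx => laP.
  by rewrite (cauchy_term_out cla laP mm) coef0.
rewrite big_filter_cond big_seq_cond [RHS]big_seq [RHS](bigID (fun la => ncore n la == de)).
(* Partitions of the box with another core are not reached by chains from [de]. *)
rewrite [X in _ = _ + X]big1; last first.
  move=> la /andP[laP ncl].
  suff -> : chain_sum n m de xvar r la = 0 by rewrite mul0r coef0.
  by apply/eqP; apply: contraNT ncl => /(chain_sum_ncore laP) ->.
rewrite [RHS]addr0; apply: eq_big => [la|la /andP[laP /andP[/eqP cla _]]].
  by congr (_ && _); apply: andb_idr => /eqP h; apply/mem_set.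
exact: (cauchy_term_in cla laP hr).
Qed.

Lemma kernel_eqm1 u v : m u = 0%N \/ m v = 0%N ->
  eqm m (cauchy_kernel n (fps_var u) (fps_var v)) 1.
Proof.
move=> h; have z0 k : eqm m (fps_var u * fps_var v * fps_q ^+ (2 * k)) 0.
  rewrite -[X in eqm _ _ X](mul0r (fps_q ^+ (2 * k))); apply: eqmMr.
  case: h => /eqm_var0 h; first by rewrite -[X in eqm _ _ X](mul0r (fps_var v)); exact: eqmMr.
  by rewrite -[X in eqm _ _ X](mulr0 (fps_var u)); exact: eqmMl.
have -> : (1 : R) = \prod_(k < n) 1 by rewrite big1.
apply: eqm_prod => k _ _.
apply: (@eqm_inv _ _ _ (1 - fps_var u * fps_var v * fps_q ^+ (2 * k)) _ 1).
- exact: kernel_inv.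
- exact: mulr1.
- move=> a am; rewrite coefD coefN (z0 k a am) coef0 subr0 //.
Qed.

Lemma finite_variables : exists r, forall i, (r <= i)%N -> m (xvar i) = 0%N /\ m (yvar i) = 0%N.
Proof.
pose f (v : V) := match v with inl i => i | inr i => i end.
exists (\max_(v <- finsupp m) f v).+1 => i hi.
have h v : f v = i -> m v = 0%N.
  move=> e; apply/eqP; rewrite cmE_eq0; apply: contraL hi => vm.
  by rewrite -ltnNge ltnS -e; exact: leq_bigmax_seq.
by split; apply: h.
Qed.

End Final.

Theorem theorem35 (n : nat) (n_gt0 : (0 < n)%N)
    (delta : partition) (delta_core : is_ncore n delta) :
  let F (la : partition) : fps {poly int} (nat + nat)%type :=
    core_ribbon_function n xvar la * core_ribbon_function n yvar la in
  let A : set partition := [set la | ncore n la = delta] in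
  fps_summable A F /\
  fps_has_prod
    (fun ij : nat * nat =>
       \prod_(k < n)
         (1 - fps_var (xvar ij.1) * fps_var (yvar ij.2) * fps_q ^+ (2 * k))^-1)
    (fps_sum A F).
Proof.
move=> F A; split=> m.
  apply: (@sub_finite_set _ _ [set` box (nbeads n m delta) (width n m delta)]); last exact: finite_seq.
  move=> la [cla Fla] /=; apply: contraT => laP.
  by move: Fla; rewrite (cauchy_term_out n_gt0 cla laP (divisors_id m)) coef0 eqxx.
have [r hr] := finite_variables m.
(* Factors outside this [r] by [r] square involve a variable that is absent from [m], so they are 1
   modulo [m]. *)
pose J0 := [fset ij in [seq (i, j) | i <- iota 0 r, j <- iota 0 r]]%fset.
pose K (ij : nat * nat) : fps {poly int} (nat + nat)%type :=
  cauchy_kernel n (fps_var (xvar ij.1)) (fps_var (yvar ij.2)).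
exists J0 => J1 sub.
rewrite -[LHS]/((\prod_(ij <- J1) K ij) m).
rewrite (cauchy_sum n_gt0 delta_core hr).
have mJ0 ij : (ij \in J0) = (ij.1 < r)%N && (ij.2 < r)%N.
  case: ij => i j; rewrite inE /=.
  apply/allpairsP/andP => [[[i' j'] /= []]|[ir jr]].
    by rewrite !mem_iota => ? ? [-> ->].
  by exists (i, j); rewrite !mem_iota.
have e1 : eqm m (\prod_(ij <- J1) K ij) (\prod_(ij <- J1) if ij \in J0 then K ij else 1).
  apply: eqm_prod => ij _ _; case: ifPn => [_|]; first exact: eqm_refl.
  rewrite mJ0 negb_and -!leqNgt => h; apply: kernel_eqm1.
  by case/orP: h => /hr[]; [left|right].
rewrite (e1 m (divisors_id m)); congr (coef _ m).
rewrite -big_mkcond /=.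
transitivity (\prod_(ij <- J0) K ij).
  rewrite -big_filter; apply: perm_big; apply: uniq_perm; rewrite ?filter_uniq ?fset_uniq //.
  move=> ij; rewrite mem_filter; apply: andb_idr; exact: (fsubsetP sub).
transitivity (\prod_(ij <- [seq (i, j) | i <- iota 0 r, j <- iota 0 r]) K ij).
  apply: perm_big; apply: uniq_perm; first exact: fset_uniq.
    by apply: allpairs_uniq; rewrite ?iota_uniq // => -[? ?] [? ?].
  by move=> ij; rewrite inE.
rewrite big_allpairs; have -> : iota 0 r = index_iota 0 r by rewrite /index_iota subn0.
by rewrite big_mkord; apply: eq_bigr => i _; rewrite big_mkord.
Qed.
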